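(* Let $\Gamma$ be a finite group and let $\lambda=(\lambda(c))_{c\in\Gamma_*}\in\mathcal P(\Gamma_* )$, where $\lambda(c)=(\lambda_1(c),\lambda_2(c),\dots)$. Then the product $\prod_{c\in\Gamma_*}K_{(\lambda_1(c))_c}K_{(\lambda_2(c))_c}\cdots$ in the Farahat–Higman ring $\mathcal G_\Gamma$ is of the form $$\prod_{c\in\Gamma_*}K_{(\lambda_1(c))_c}K_{(\lambda_2(c))_c}\cdots=\sum_{\mu\ge\lambda}d_{\lambda\mu}K_\mu$$ with $d_{\lambda\mu}\in\mathbb Z_{\ge0}$ and $d_{\lambda\lambda}>0$. In particular, the elements $K_{(r)_c}$, where $r\ge1$, $c\in\Gamma_*$, are algebraically independent elements of $\mathcal G_\Gamma$, and they generate $\mathbb Q\otimes_\mathbb{Z}\mathcal G_\Gamma$.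
   Context: $\Gamma_*$ is the set of conjugacy classes of $\Gamma$, and $c^0=\{1\}$. $S_n$ acts on $\Gamma^n$ by $\sigma(g_1,\dots,g_n)=(g_{\sigma^{-1}(1)},\dots,g_{\sigma^{-1}(n)})$, and $\Gamma_n=\Gamma^n\rtimes S_n$ with $(g,\sigma)(h,\tau)=(g\,\sigma(h),\sigma\tau)$. For $x=(g,\sigma)$ and a cycle $(i_1\cdots i_k)$ of $\sigma$ (fixed points are 1-cycles), the cycle-product is $g_{i_k}\cdots g_{i_1}$, well defined up to conjugacy. $\mathcal P(\Gamma_* )$ is the set of partition-valued functions on $\Gamma_*$; $\|\lambda\|=\sum_c|\lambda(c)|$; $\ell$ is the number of parts of a partition; $\mathcal P_n(\Gamma_* )=\{\lambda\in\mathcal P(\Gamma_* )\mid\|\lambda\|=n\}$. $(r)_c\in\mathcal P(\Gamma_* )$ has the one-part partition $(r)$ at $c$ and empty partitions elsewhere. The partial ordering $\ge$ on $\mathcal P_n(\Gamma_* )$ is defined as follows: given $\lambda,\mu\in\mathcal P_n(\Gamma_* )$, $\mu\ge\lambda$ if $\mu(c^0)$ is strictly contained in $\lambda(c^0)$ (containment of partitions meaning that $\mu(c^0)$ consists of some of the parts of $\lambda(c^0)$), or if $\mu(c)\ge\lambda(c)$ in the dominance order for each $c\in\Gamma_*$ in the case when $|\lambda(c)|=|\mu(c)|$ for all $c\in\Gamma_*$. The type $\rho$ of $x\in\Gamma_n$: the number of parts of $\rho(c)$ equal to $i$ is the number of $i$-cycles of $\sigma$ with cycle-product in $c$. The modified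 type $\lambda$: $\lambda(c)=\rho(c)$ for $c\ne c^0$, and $\lambda(c^0)$ is obtained from $\rho(c^0)$ by subtracting 1 from every part (zeros discarded). $K_\lambda(n)\in\mathbb Z[\Gamma_n]$ is the sum of all elements of $\Gamma_n$ of modified type $\lambda$; it is nonzero iff $\|\lambda\|+\ell(\lambda(c^0))\le n$, and the nonzero ones form a $\mathbb Z$-basis of the center of $\mathbb Z[\Gamma_n]$. Write $K_\lambda(n)K_\mu(n)=\sum_\nu a_{\lambda\mu}^\nu(n)K_\nu(n)$. When $\|\nu\|=\|\lambda\|+\|\mu\|$, the number $a_{\lambda\mu}^\nu(n)$ is the same for all $n\ge\|\nu\|+\ell(\nu(c^0))$ and is denoted $a_{\lambda\mu}^\nu$. The Farahat–Higman ring $\mathcal G_\Gamma$ is the commutative ring with $\mathbb Z$-basis $(K_\lambda)_{\lambda\in\mathcal P(\Gamma_* )}$ and multiplication $K_\lambda K_\mu=\sum_{\|\nu\|=\|\lambda\|+\|\mu\|}a_{\lambda\mu}^\nu K_\nu$.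
   Formalization: The relation ≥ as defined (strict containment at c^0, or dominance with equal sizes) is not transitive, and the expansion fails for it when Γ≠1 (e.g. K_{(1)_{c^0}}^4); here ≥ is the partial order it generates, i.e. its transitive closure. *)

(* Defs.v *)
From HB Require Import structures.
From mathcomp Require Import all_boot all_order all_algebra all_fingroup.
From mathcomp Require Import mpoly.
From Stdlib Require Import Relation_Operators.

Set Implicit Arguments.
Unset Strict Implicit.
Unset Printing Implicit Defensive.

Import GRing.Theory.

(* Partitions: weakly decreasing sequences of positive integers. *)
Definition is_partition (s : seq nat) : bool := sorted geq s && (0 \notin s).

Record partition := Partition {
  parts :> seq nat;
  partsP : is_partition parts
}.

HB.instance Definition _ := [isSub for parts].
HB.instance Definition _ := [Equality of partition by <:].

Lemma mkpart_subproof (s : seq nat) :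
  is_partition (sort geq [seq i <- s | 0 < i]).
Proof.
rewrite /is_partition sort_sorted; last by move=> m n; exact: leq_total.
by rewrite mem_sort mem_filter.
Qed.

(* Zero entries are discarded. *)
Definition mkpart (s : seq nat) : partition := Partition (mkpart_subproof s).

Definition psize (p : partition) : nat := sumn p.

Definition dominates (p q : partition) : Prop :=
  forall k, sumn (take k q) <= sumn (take k p).

(* Containment in the sense of multisets of parts. *)
Definition strictly_contained (p q : partition) : Prop :=
  (forall i, count_mem i p <= count_mem i q) /\ p <> q.

Lemma mkpart_id (p : partition) : mkpart p = p.
Proof.
apply: val_inj => /=; case: p => s /= /andP[srt s0].
rewrite (_ : [seq i <- s | 0 < i] = s).
  by apply: sorted_sort => // m n k nm /leq_trans; apply.
apply/all_filterP/allP => i si; rewrite lt0n; apply: contraNneq s0.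
by move=> <-.
Qed.

Lemma mkpart_nseq0 (p : partition) k : mkpart (p ++ nseq k 0) = p.
Proof.
rewrite -[RHS]mkpart_id; apply: val_inj => /=.
by rewrite filter_cat [X in _ ++ X](_ : _ = [::]) ?cats0 //; elim: k.
Qed.

Lemma size_partition (p : partition) : size p <= psize p.
Proof.
rewrite /psize; case: p => s /= /andP[_]; elim: s => //= x s ihs.
rewrite inE negb_or eq_sym -lt0n => /andP[x0 /ihs hs].
by rewrite -add1n leq_add.
Qed.

Lemma leq_part_size (p : partition) i : i \in parts p -> i <= psize p.
Proof.
rewrite /psize; elim: (parts p) => //= x s ihs.
rewrite inE => /orP[/eqP->|/ihs hs]; first exact: leq_addr.
exact: leq_trans hs (leq_addl _ _).
Qed.

Section WreathProduct.

Variable gT : finGroupType.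

(* Conjugacy classes of the finite group [set: gT], and that of 1. *)
Definition conjClass := {c : {set gT} | c \in classes [set: gT]}.

Definition cclass (g : gT) : conjClass :=
  exist _ (g ^: [set: gT])%g (mem_classes (in_setT g)).

Definition c0 : conjClass := cclass 1%g.

Definition ptype := {ffun conjClass -> partition}.

Definition norm (la : ptype) : nat := \sum_(c : conjClass) psize (la c).

Definition single (r : nat) (c : conjClass) : ptype :=
  [ffun c' => if c' == c then mkpart [:: r] else mkpart [::]].

(* All elements of norm m, listed once each (see mem_ptypes): a partition of
   size at most m is padded by zeros to an m-tuple with entries at most m. *)
Definition ptypes (m : nat) : seq ptype :=
  [seq la <- undup [seq [ffun c => mkpart [seq nat_of_ord i | i <- t c]]
                      | t : {ffun conjClass -> m.-tuple 'I_m.+1}]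
     | norm la == m].

Lemma mem_ptypes m (la : ptype) : (la \in ptypes m) = (norm la == m).
Proof.
rewrite mem_filter; case: eqP => //= lam; rewrite mem_undup.
have le c : psize (la c) <= m.
  by rewrite -lam /norm (bigD1 c) //= leq_addr.
pose s c := [seq inord i : 'I_m.+1 | i <- la c ++ nseq (m - size (la c)) 0].
have szs c : size (s c) == m.
  rewrite size_map size_cat size_nseq subnKC //.
  exact: leq_trans (size_partition _) (le c).
apply/imageP; exists [ffun c => Tuple (szs c)] => //.
apply/ffunP => c; rewrite !ffunE /= -map_comp.
rewrite -[LHS](mkpart_nseq0 _ (m - size (la c))).
congr mkpart; rewrite -[LHS]map_id; apply/eq_in_map => i.
rewrite mem_cat mem_nseq => ii /=; rewrite inordK // ltnS.
case/orP: ii => [/leq_part_size/leq_trans|/andP[_ /eqP->] //].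
exact.
Qed.

Lemma ptypes_uniq m : uniq (ptypes m).
Proof. exact/filter_uniq/undup_uniq. Qed.

Definition ge_step (mu la : ptype) : Prop :=
  norm mu = norm la /\
  (strictly_contained (mu c0) (la c0) \/
   forall c, psize (la c) = psize (mu c) /\ dominates (mu c) (la c)).

(* ge_step is reflexive but not transitive: with only (1,1,1,1), (2,1,1), (2)
   at c0 respectively, la <= la' holds by dominance and la' <= mu by
   containment, but not la <= mu. The partial order is the one it generates. *)
Definition ptype_ge : ptype -> ptype -> Prop := clos_trans ptype ge_step.

Section Degree.

Variable n : nat.

Record wreath := Wreath { wbase : {ffun 'I_n -> gT}; wperm : {perm 'I_n} }.

Definition wreath_pair (x : wreath) := (wbase x, wperm x).
Definition pair_wreath (p : {ffun 'I_n -> gT} * {perm 'I_n}) :=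
  Wreath p.1 p.2.

Lemma wreath_pairK : cancel wreath_pair pair_wreath.
Proof. by case. Qed.

HB.instance Definition _ := Finite.copy wreath (can_type wreath_pairK).

Definition wreath_one : wreath := Wreath [ffun => 1%g] 1%g.

(* (g, s)(h, t) = (g s(h), s o t) with s(h)_i = h_(s^-1 i); the product of
   permutations of the library is s * t = t o s, whence the swap. *)
Definition wreath_mul (x y : wreath) : wreath :=
  Wreath [ffun i => (wbase x i * wbase y ((wperm x)^-1%g i))%g]
         (wperm y * wperm x)%g.

Definition wreath_inv (x : wreath) : wreath :=
  Wreath [ffun i => ((wbase x (wperm x i))^-1)%g] (wperm x)^-1%g.

Lemma wreath_mulA : associative wreath_mul.
Proof.
move=> x y z; congr Wreath; last by rewrite /= mulgA.
by apply/ffunP => i; rewrite !ffunE /= invMg permM mulgA.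
Qed.

Lemma wreath_mul1 : left_id wreath_one wreath_mul.
Proof.
case=> g s; congr Wreath; last by rewrite /= mulg1.
by apply/ffunP => i; rewrite !ffunE /= invg1 perm1 mul1g.
Qed.

Lemma wreath_mulV : left_inverse wreath_one wreath_inv wreath_mul.
Proof.
case=> g s; congr Wreath; last by rewrite /= mulgV.
by apply/ffunP => i; rewrite !ffunE /= invgK mulVg.
Qed.

HB.instance Definition _ :=
  Finite_isGroup.Build wreath wreath_mulA wreath_mul1 wreath_mulV.

(* For the cycle (i_1 ... i_k) of wperm x through i = i_1, with
   i_(j+1) = wperm x i_j, this is g_(i_k) ... g_(i_1). *)
Definition cycle_product (x : wreath) (i : 'I_n) : gT :=
  (\prod_(j <- rev (traject (wperm x) i #|porbit (wperm x) i|)) wbase x j)%g.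

Definition wtype (x : wreath) : ptype :=
  [ffun c => mkpart [seq #|B| | B : {set 'I_n} <- enum (porbits (wperm x))
                       & [exists i in B, cclass (cycle_product x i) == c]]].

Definition mtype (x : wreath) : ptype :=
  [ffun c => if c == c0 then mkpart [seq r.-1 | r <- wtype x c0]
             else wtype x c].

(* The group ring Z[Gamma_n], as functions with the convolution product. *)
Definition zgroup_ring := {ffun wreath -> int}.

Definition conv (f h : zgroup_ring) : zgroup_ring :=
  [ffun z => \sum_(p : wreath * wreath | (p.1 * p.2)%g == z) f p.1 * h p.2]%R.

Definition class_sum (la : ptype) : zgroup_ring :=
  [ffun x => (mtype x == la)%:R]%R.

(* The coefficient of K_nu(n) in K_la(n) K_mu(n): the latter is constant on
   the elements of modified type nu, and the supports of the various K_nu(n)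
   are disjoint, so it is the value at any element of modified type nu (and
   it is irrelevant when there is none, as K_nu(n) = 0 then). *)
Definition str_const (la mu nu : ptype) : int :=
  if [pick z | mtype z == nu] is Some z
  then conv (class_sum la) (class_sum mu) z else 0%R.

End Degree.

(* The common value of a_(la mu)^nu(n) for n >= norm nu + size (nu c0), when
   norm nu = norm la + norm mu. *)
Definition stable_const (la mu nu : ptype) : int :=
  str_const (norm nu + size (nu c0)) la mu nu.

End WreathProduct.

Local Open Scope ring_scope.

Definition is_Zbasis (V : zmodType) (I : eqType) (b : I -> V) : Prop :=
  (forall x, exists (s : seq I) (d : I -> int),
      x = \sum_(i <- s) b i *~ d i) /\
  (forall (s : seq I) (d : I -> int), uniq s ->
      \sum_(i <- s) b i *~ d i = 0 -> {in s, forall i, d i = 0}).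

(* G, with the family K, is the Farahat-Higman ring; this determines (G, K)
   up to a unique isomorphism. *)
Definition is_Farahat_Higman (gT : finGroupType) (G : comNzRingType)
    (K : ptype gT -> G) : Prop :=
  is_Zbasis K /\
  forall la mu, K la * K mu =
    \sum_(nu <- ptypes gT (norm la + norm mu)) K nu *~ stable_const la mu nu.

(* A, with iota : g |-> 1 (x) g, is the Q-algebra Q (x)_Z G: the universal
   property of the extension of scalars from Z to Q. *)
Definition is_Q_tensor (G : comNzRingType) (A : comAlgType rat)
    (iota : {rmorphism G -> A}) : Prop :=
  forall (V : lmodType rat) (f : {additive G -> V}),
    exists h : {linear A -> V}, (forall x, h (iota x) = f x) /\
      forall h' : {linear A -> V}, (forall x, h' (iota x) = f x) -> h' =1 h.

(* Over Z: every finite subfamily satisfies no nontrivial polynomial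
   relation. *)
Definition algebraically_independent (G : comNzRingType) (I : Type)
    (x : I -> G) : Prop :=
  forall (n : nat) (f : 'I_n -> I), injective f ->
  forall p : {mpoly int[n]}, mmap intr (fun i => x (f i)) p = 0 -> p = 0.

Definition generates (F : fieldType) (A : comAlgType F) (I : Type)
    (x : I -> A) : Prop :=
  forall a : A, exists (n : nat) (f : 'I_n -> I) (p : {mpoly F[n]}),
    a = mmap (in_alg A) (fun i => x (f i)) p.

(* Main.v *)
Require Import Defs.
From HB Require Import structures.
From mathcomp Require Import all_boot all_order all_algebra all_fingroup.
From mathcomp Require Import mpoly.
From mathcomp Require Import zify.
From Stdlib Require Import Relation_Operators IndefiniteDescription.
From Stdlib Require Import ClassicalEpsilon.

(** Let [x] and [y] be elements of the wreath product of degree [n], let [y] be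
    of modified type [(r)_c], that is a single cycle with support [D] and
    cycle-product in [c], and let [z = x * y]. The cycles of [x] and of [z] that
    do not meet [D] are the same. The norm of a modified type is [n] minus the
    number of trivial cycles, i.e. those with cycle-product 1 ([norm_mtype]).
    So if the norms of [x] and [y] add up in [z], then the number of trivial
    cycles of [x] that meet [D] exceeds by [r] that of [z]. But at most
    [#|D| = r + (c == c0)] cycles of [x] meet [D]. This leaves few cases
    ([mtype_mul_single]).

    - No trivial cycle of [z] meets [D]. Then the parts of [z] at [c0] are among
      those of [x], and [z] is above the union of the type of [x] and of [(r)_c]
      by strict containment, unless [c] is not [c0] and the points of [D] are
      trivial 1-cycles of [x], in which case the type of [z] is this union.

    - One trivial cycle of [z] meets [D]. Then [c = c0], and the [r + 1] points
      of [D] are in distinct trivial cycles of [x], which are merged into one.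
      Their parts [a_0, ..., a_r] and [r] are replaced with their sum, and the
      type of [z] dominates the union ([merge_dominates]).

    Conversely, an element whose type is the union of [la] and [(r)_c] factors
    by splitting off one cycle ([factor_add_part]), so the coefficient of the
    union itself is positive. As the order is compatible with unions of types,
    the expansion of a product follows by induction on the number of factors
    ([prod_expansion]).

    Dominance is handled through the excesses, the sums over the parts [i] of
    [max(i - t, 0)], which are additive under unions ([dominates_excess]). They
    also give a weight that is strictly increasing for the order on types
    ([ptype_ge_weight]). The expansion is thus triangular: a relation between
    the generators has a nonzero coefficient at a type of minimal weight among
    those of its monomials ([gen_algebraically_independent]), and descending
    induction on the weight writes every [K la] as a rational combination of
    products of generators ([combination_K]). By the universal property of the
    extension of scalars, such combinations fill the whole algebra
    ([combination_all]). *)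

Set Implicit Arguments.
Unset Strict Implicit.
Unset Printing Implicit Defensive.

Import GRing.Theory.

Local Notation partition := Defs.partition.

(** * Partitions, dominance and excesses *)

Lemma count_part0 (p : partition) : count_mem 0 p = 0.
Proof. by apply/count_memPn; case: p => s /= /andP[]. Qed.

Lemma part_eq (p q : partition) :
  (forall i, 0 < i -> count_mem i p = count_mem i q) -> p = q.
Proof.
move=> h; apply: val_inj => /=.
have srt (r : partition) : sorted geq r by case: r => s /= /andP[].
apply: (sorted_eq _ _ (srt p) (srt q)).
- by move=> m n k nm /leq_trans; apply.
- by move=> m n /anti_leq.
apply/allP => -[|i] _ /=; last by rewrite h.
by rewrite !count_part0.
Qed.

Lemma count_mkpart s i : 0 < i -> count_mem i (mkpart s) = count_mem i s.
Proof.
move=> i0; rewrite /= (seq.permP (permEl (perm_sort _ _))) count_filter.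
by apply: eq_count => j /=; case: eqP => // ->.
Qed.

Lemma big_mkpart s (F : nat -> nat) : F 0 = 0 ->
  \sum_(i <- mkpart s) F i = \sum_(i <- s) F i.
Proof.
move=> F0; rewrite /= (perm_big _ (permEl (perm_sort _ _))) big_filter.
rewrite [RHS](bigID (fun i => 0 < i)) /= [X in _ = _ + X]big1 ?addn0 //.
by case.
Qed.

(** The part of [s] above height [t], i.e. the sum of [max(i - t, 0)]. *)
Definition excess t (s : seq nat) := \sum_(i <- s) (i - t).

Lemma psizeE (p : partition) : psize p = excess 0 p.
Proof. by rewrite /psize sumnE /excess; apply: eq_bigr => i _;
  rewrite subn0. Qed.

Lemma excess_mkpart t s : excess t (mkpart s) = excess t s.
Proof. exact: big_mkpart. Qed.

Lemma excess_cat t s1 s2 : excess t (s1 ++ s2) = excess t s1 + excess t s2.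
Proof. by rewrite /excess big_cat. Qed.

Lemma excess1 t r : excess t [:: r] = r - t.
Proof. by rewrite /excess big_seq1. Qed.

Lemma excess_sum t s : excess t s <= sumn s - t.
Proof.
rewrite /excess; elim: s => [|a s ih]; first by rewrite big_nil.
by rewrite big_cons /=; lia.
Qed.

Lemma excess_le t s : excess t s <= sumn s.
Proof. exact: leq_trans (excess_sum _ _) (leq_subr _ _). Qed.

(** For a partition, the sum of the first [k] parts is the minimum over [t] of
    [k * t + excess t s], attained when [t] is the part of index [k]. *)
Lemma sumn_take_le k t s : sumn (take k s) <= k * t + excess t s.
Proof.
rewrite /excess; elim: s k => [|a s ih] [|k] //=; rewrite big_cons.
by have := ih k; lia.
Qed.

Lemma sumn_take_sorted k s : sorted geq s ->
  sumn (take k s) = k * nth 0 s k + excess (nth 0 s k) s.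
Proof.
rewrite /excess; elim: s k => [|a s ih] [|k] //= srt.
- by rewrite muln0 big_nil.
- by rewrite muln0 big_nil.
- rewrite big_cons subnn mul0n !add0n.
  rewrite big_seq big1 // => i si.
  have /allP/(_ i si) : all (geq a) s.
    by apply: order_path_min srt => m n o nm /leq_trans; apply.
  by move=> /= le; apply/eqP.
rewrite big_cons (ih k (path_sorted srt)).
suff : nth 0 s k <= a by lia.
have [ks|] := ltnP k (size s); last by move=> ks; rewrite nth_default.
have /allP/(_ _ (mem_nth 0 ks)) // : all (geq a) s.
by apply: order_path_min srt => m n o nm /leq_trans; apply.
Qed.

Lemma excess_sorted t s : sorted geq s -> let k := count (ltn t) s in
  excess t s + k * t = sumn (take k s).
Proof.
rewrite /excess /=; elim: s => [|a s ih] /= srt; first by rewrite big_nil.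
have := ih (path_sorted srt).
have [ta|at'] := ltnP t a; first by rewrite big_cons /= add0n; nia.
suff s0 : all (fun i => i <= t) s.
  have -> : count [pred n | t < n] s = 0.
    by apply/eqP; rewrite -leqn0 leqNgt -has_count -all_predC;
       apply: sub_all s0 => i /=; rewrite -leqNgt.
  by rewrite big_cons /= !take0 /=; lia.
have : all (geq a) s.
  by apply: order_path_min srt => m n o nm /leq_trans; apply.
by apply: sub_all => i /= /leq_trans; apply.
Qed.

(** Dominance is the pointwise comparison of excesses, a description that is
    additive under unions of partitions. *)
Lemma dominates_excess (p q : partition) :
  dominates p q <-> forall t, excess t q <= excess t p.
Proof.
have srt (r : partition) : sorted geq r by case: r => s /= /andP[].
split=> [dom t|dom k].
  have := excess_sorted t (srt q); rewrite /=.
  have := dom (count (ltn t) q); have := sumn_take_le (count (ltn t) q) t p.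
  by lia.
rewrite (sumn_take_sorted k (srt p)).
exact: leq_trans (sumn_take_le _ (nth 0 p k) _) (leq_add _ (dom _)).
Qed.

(** The second difference of [excess t s] in [t] counts the parts of each
    size. *)
Lemma excess_inj (p q : partition) :
  (forall t, excess t p = excess t q) -> p = q.
Proof.
move=> h; apply: part_eq => -[//|i] _.
have E s : excess i s + excess i.+2 s = (excess i.+1 s).*2 + count_mem i.+1 s.
  rewrite /excess; elim: s => [|a s ih]; first by rewrite !big_nil.
  by rewrite !big_cons /= in ih *; case: eqP => [->|]; lia.
by have := E p; rewrite !h E => /addnI.
Qed.

(** * The order on partition-valued functions *)

Section Types.
Variable gT : finGroupType.
Implicit Types la mu nu : ptype gT.
Notation c0 := (c0 gT).

Lemma ptype_eq la mu :
  (forall c i, 0 < i -> count_mem i (la c) = count_mem i (mu c)) -> la = mu.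
Proof. by move=> h; apply/ffunP => c; apply: part_eq => i /h. Qed.

(** The multiset union of [la] and of the part [r] at [c]. *)
Definition add_part la r c : ptype gT :=
  [ffun c' => mkpart (la c' ++ nseq (c' == c) r)].

Lemma count_add_part la r c c' i : 0 < i ->
  count_mem i (add_part la r c c') = count_mem i (la c') + (c' == c) * (r == i).
Proof.
by move=> i0; rewrite ffunE count_mkpart // count_cat count_nseq /= mulnC.
Qed.

Lemma excess_add_part t la r c c' :
  excess t (add_part la r c c') = excess t (la c') + (c' == c) * (r - t).
Proof.
rewrite ffunE excess_mkpart excess_cat; congr (_ + _).
by case: (c' == c); rewrite ?excess1 ?mul1n // /excess big_nil.
Qed.

Lemma norm_add_part la r c : norm (add_part la r c) = norm la + r.
Proof.
rewrite /norm.
under eq_bigr => i _ do rewrite psizeE excess_add_part subn0 -psizeE.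
rewrite big_split /=; congr (_ + _).
rewrite (bigD1 c) //= eqxx mul1n big1 ?addn0 // => i /negPf->.
by rewrite mul0n.
Qed.

Lemma add_part_inj r c : injective (fun la => add_part la r c).
Proof.
move=> la mu /ffunP e; apply: ptype_eq => c' i i0.
by have := congr1 (fun p : partition => count_mem i p) (e c');
   rewrite !count_add_part // => /addIn.
Qed.

(** The empty type. *)
Definition ptype0 : ptype gT := [ffun=> mkpart [::]].

Lemma norm_ptype0 : norm ptype0 = 0.
Proof. by rewrite /norm big1 // => c _; rewrite ffunE. Qed.

Lemma singleE r c : single r c = add_part ptype0 r c.
Proof.
apply: ptype_eq => c' i i0; rewrite count_add_part // !ffunE.
rewrite (count_mkpart [::]) //=.
case: ifP => _; last by rewrite (count_mkpart [::]).
by rewrite count_mkpart //= addn0 mul1n.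
Qed.

Lemma norm_single r c : norm (@single gT r c) = r.
Proof. by rewrite singleE norm_add_part norm_ptype0. Qed.

Lemma ge_step_refl la : ge_step la la.
Proof. by split=> //; right=> c; split=> // k. Qed.

Lemma ge_step_add mu la r c : ge_step mu la ->
  ge_step (add_part mu r c) (add_part la r c).
Proof.
move=> [nrm H]; split; first by rewrite !norm_add_part nrm.
case: H => [[le ne]|dom]; [left|right].
  split.
    case=> [|i]; first by rewrite !count_part0.
    by rewrite !count_add_part // leq_add2r le.
  move=> e; apply: ne; apply: part_eq => i i0.
  have := congr1 (fun p : partition => count_mem i p) e.
  by rewrite !count_add_part // => /addIn.
move=> c'; have [sz /dominates_excess dm] := dom c'; split.
  by rewrite !psizeE !excess_add_part -!psizeE sz.
by apply/dominates_excess => t; rewrite !excess_add_part leq_add2r.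
Qed.

Lemma ptype_ge_refl la : ptype_ge la la.
Proof. exact/t_step/ge_step_refl. Qed.

Lemma ptype_ge_trans la mu nu :
  ptype_ge nu mu -> ptype_ge mu la -> ptype_ge nu la.
Proof. exact: t_trans. Qed.

Lemma ptype_ge_add mu la r c : ptype_ge mu la ->
  ptype_ge (add_part mu r c) (add_part la r c).
Proof.
elim=> [nu ka st|nu ka om _ ih1 _ ih2]; first exact/t_step/ge_step_add.
exact: t_trans ih1 ih2.
Qed.

(** A numerical function that is strictly increasing for [ptype_ge]: strict
    containment lowers the size of the partition at [c0] and weighs more than
    any change of the excesses, and dominance raises the latter. *)
Definition weight la :=
  (norm la - psize (la c0)) * (norm la).+1 ^ 2 +
  \sum_(c : conjClass gT) \sum_(t < norm la) excess t (la c).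

Lemma psize_le_norm la c : psize (la c) <= norm la.
Proof. by rewrite /norm (bigD1 c) //= leq_addr. Qed.

Lemma weight_small la :
  \sum_(c : conjClass gT) \sum_(t < norm la) excess t (la c) < (norm la).+1 ^ 2.
Proof.
apply: (@leq_ltn_trans (norm la * norm la)); last by rewrite -mulnn; nia.
rewrite {2}/norm big_distrr leq_sum //= => c _.
apply: (@leq_trans (\sum_(t < norm la) psize (la c))).
  by apply: leq_sum => t _; apply: excess_le.
by rewrite sum_nat_const card_ord.
Qed.

Lemma weight_bound la : weight la < (norm la).+1 ^ 3.
Proof.
have := weight_small la; rewrite /weight (expnS _ 2) mulSn.
set u := \sum_c _; set B := _ ^ 2 => uB.
by rewrite addnC -addSn leq_add // leq_mul2r leq_subr orbT.
Qed.

Lemma strictly_contained_psize (p q : partition) :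
  strictly_contained p q -> psize p < psize q.
Proof.
move=> [le ne]; have sub : exists2 s, perm_eq q (p ++ s) & s != [::].
  have : exists s, perm_eq q (p ++ s).
    elim: (parts p) (parts q) le => [|a s ih] t le; first by exists t.
    have ta : a \in t.
      by rewrite -has_pred1 has_count; apply: leq_trans (le a); rewrite /= eqxx.
    have [u pu] : exists u, perm_eq (rem a t) (s ++ u).
      apply: ih => i; have := le i; rewrite (seq.permP (perm_to_rem ta)) /=.
      by rewrite leq_add2l.
    exists u; apply: (perm_trans (perm_to_rem ta)).
    by rewrite perm_cons.
  case=> -[|a s] pu; last by exists (a :: s).
  by case: ne; apply: part_eq => i _; rewrite (seq.permP pu) cats0.
case: sub => -[//|a s] pq _.
rewrite /psize (perm_sumn pq) sumn_cat /=.
suff : 0 < a by lia.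
rewrite lt0n; apply/eqP => a0.
by have := count_part0 q; rewrite (seq.permP pq) count_cat a0 /=; lia.
Qed.

Lemma ge_step_weight mu la : ge_step mu la ->
  weight la <= weight mu ?= iff (la == mu).
Proof.
move=> [nrm H].
have sm := weight_small mu; have sl := weight_small la.
have pl := psize_le_norm la c0; have pm := psize_le_norm mu c0.
rewrite nrm in sm pm.
case: H => [/strictly_contained_psize lt|dom].
  suff h : weight la < weight mu.
    split; first exact: ltnW.
    rewrite (ltn_eqF h).
    by apply/esym/eqP => e; rewrite e ltnn in lt.
  rewrite /weight nrm; move: sm sl.
  set B := _ ^ 2; set u := \sum_c _; set v := \sum_c _ => sm sl.
  apply: (@leq_trans ((norm la - psize (la c0)).+1 * B));
    first by rewrite mulSn; lia.
  apply: leq_trans (leq_addr _ _); rewrite leq_mul2r; apply/orP; right; lia.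
rewrite /weight nrm.
have E c t : excess t (la c) <= excess t (mu c).
  by have [_ /dominates_excess] := dom c.
have -> : psize (mu c0) = psize (la c0) by have [->] := dom c0.
split; first by rewrite leq_add2l; do 2!apply: leq_sum => ? _; apply: E.
rewrite eqn_add2l.
have {}H := @leqif_sum (conjClass gT) predT _ _ _ (fun c _ =>
  @leqif_sum 'I_(norm la) predT _ _ _ (fun t _ => leqif_eq (E c t))).
rewrite (eq_leqif H); apply/forall_inP/eqP => [h|-> c _]; last exact/forall_inP.
apply/ffunP => c; apply: excess_inj => t.
have /forall_inP hc := h c isT.
have [tn|nt] := ltnP t (norm la); first exact/eqP/(hc (Ordinal tn) isT).
have z nu : norm nu = norm la -> excess t (nu c) = 0.
  move=> e; apply/eqP; rewrite -leqn0; apply: leq_trans (excess_sum _ _) _.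
  have := psize_le_norm nu c; rewrite /psize e; lia.
by rewrite !z.
Qed.

Lemma ptype_ge_weight mu la : ptype_ge mu la ->
  weight la <= weight mu ?= iff (la == mu).
Proof.
elim=> [nu ka /ge_step_weight //|nu ka om _ ih1 _ ih2].
have := leqif_trans ih2 ih1; case=> le e; split=> //; rewrite e.
apply/andP/eqP => [[/eqP-> /eqP->] //|e1].
rewrite e1 in ih2 *.
have : weight nu == weight ka by rewrite eqn_leq ih1 ih2.
by rewrite (eq_leqif ih2) eq_sym => /eqP->.
Qed.

End Types.

(** * Cycles of the elements of the wreath product *)

Section Cycles.
Variables (gT : finGroupType) (n : nat).
Implicit Types (x y z : wreath gT n) (D B : {set 'I_n}) (c : conjClass gT).
Notation c0 := (c0 gT).

Lemma mem_traject_porbit (s : {perm 'I_n}) i j :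
  (j \in traject s i #|porbit s i|) = (j \in porbit s i).
Proof. by rewrite porbit_traject. Qed.

Lemma cclassJ (g h : gT) : cclass (g ^ h)%g = cclass g.
Proof. by apply: val_inj; rewrite /= classGidl ?inE. Qed.

Lemma porbit_step (s : {perm 'I_n}) i : porbit s (s i) = porbit s i.
Proof. exact: (porbit_perm s 1). Qed.

Lemma cclass_cycle_step x i :
  cclass (cycle_product x (wperm x i)) = cclass (cycle_product x i).
Proof.
(* The two products differ by moving the factor of [i] to the other end. *)
rewrite /cycle_product porbit_step; set s := wperm x.
case def_k: #|porbit s i| (iter_porbit s i) => [|k] it.
  by have := card_porbit_neq0 s i; rewrite def_k.
rewrite [traject s (s i) _]trajectSr -iterSr it [traject s i _]trajectS.
rewrite rev_cons rev_rcons big_cons -cats1.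
rewrite big_cat big_seq1 -(cclassJ _ (wbase x i)).
by rewrite /= conjgE -mulgA mulKg.
Qed.

Lemma cclass_cycle x i j : j \in porbit (wperm x) i ->
  cclass (cycle_product x j) = cclass (cycle_product x i).
Proof.
case/porbitP => k ->; elim: k => [|k ih]; first by rewrite expg0 perm1.
by rewrite expgSr permM cclass_cycle_step.
Qed.

(** The class of the cycle-products of the cycle of [x] with support [B]; it
    is [c0] by convention if [B] is empty. *)
Definition cycle_class x B : conjClass gT :=
  if [pick i in B] is Some i then cclass (cycle_product x i) else c0.

Lemma cycle_classE x i :
  cycle_class x (porbit (wperm x) i) = cclass (cycle_product x i).
Proof.
rewrite /cycle_class; case: pickP => [j|/(_ i)]; last by rewrite porbit_id.
exact: cclass_cycle.
Qed.

(** The supports of the cycles of [x]. *)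
Definition cycles x := porbits (wperm x).

Lemma cyclesP x B : reflect (exists i, B = porbit (wperm x) i) (B \in cycles x).
Proof. by apply: (iffP imsetP) => [[i _ ->]|[i ->]]; exists i. Qed.

Lemma mem_cycles x i : porbit (wperm x) i \in cycles x.
Proof. by apply/cyclesP; exists i. Qed.

Lemma cycle_eq x B i : B \in cycles x -> i \in B -> B = porbit (wperm x) i.
Proof. by case/cyclesP => j -> ij; apply/eqP; rewrite eq_sym eq_porbit_mem. Qed.

Lemma cycle_inj x B B' i :
  B \in cycles x -> B' \in cycles x -> i \in B -> i \in B' -> B = B'.
Proof. by move=> Bx B'x /(cycle_eq Bx)-> /(cycle_eq B'x)->. Qed.

Lemma cycle_gt0 x B : B \in cycles x -> 0 < #|B|.
Proof. by case/cyclesP => i ->; rewrite lt0n card_porbit_neq0. Qed.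

Lemma cycle_step x B i : B \in cycles x -> (wperm x i \in B) = (i \in B).
Proof.
move=> Bx; apply/idP/idP => iB; last first.
  by rewrite (cycle_eq Bx iB) (mem_porbit _ 1).
by rewrite (cycle_eq Bx iB) porbit_step porbit_id.
Qed.

Lemma exists_cycle_class x B c : B \in cycles x ->
  [exists i in B, cclass (cycle_product x i) == c] = (cycle_class x B == c).
Proof.
case/cyclesP => i ->; rewrite cycle_classE.
apply/exists_inP/eqP => [[j ji /eqP<-]|<-]; first exact/esym/cclass_cycle.
by exists i; rewrite ?porbit_id.
Qed.

Lemma count_wtype x c i : 0 < i ->
  count_mem i (wtype x c) =
  #|[set B in cycles x | (cycle_class x B == c) && (#|B| == i)]|.
Proof.
move=> i0; rewrite ffunE count_mkpart // count_map -size_filter.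
rewrite -(card_uniqP (filter_uniq _ (filter_uniq _ (enum_uniq _)))).
apply: eq_card => B.
rewrite inE !mem_filter -enumT mem_enum andbT -/(cycles x) /=.
have [Bx|_] := boolP (B \in cycles x); last by rewrite !andbF.
by rewrite exists_cycle_class // andbT andbC.
Qed.

(** A cycle of length [k] contributes a part [k - (c == c0)] to the modified
    type. *)
Lemma count_mtype x c i : 0 < i ->
  count_mem i (mtype x c) =
  #|[set B in cycles x | (cycle_class x B == c) && (#|B| == i + (c == c0))]|.
Proof.
move=> i0; rewrite ffunE; case: eqP => [->|_];
  last by rewrite addn0 count_wtype.
rewrite count_mkpart // count_map addn1 -count_wtype //.
by apply: eq_count => j /=; lia.
Qed.

Lemma sum_mtype (F : nat -> nat) x c : F 0 = 0 ->
  \sum_(i <- mtype x c) F i =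
  \sum_(B in cycles x | cycle_class x B == c) F (#|B| - (c == c0)).
Proof.
have E F' : F' 0 = 0 -> \sum_(i <- wtype x c) F' i =
    \sum_(B in cycles x | cycle_class x B == c) F' #|B|.
  move=> F0; rewrite ffunE big_mkpart // big_map big_filter big_enum_cond /=.
  apply: eq_bigl => B; rewrite -/(cycles x).
  by have [Bx|//] := boolP (B \in cycles x); rewrite exists_cycle_class.
move=> F0; rewrite ffunE; case: eqP => [e|_]; last first.
  by rewrite E //; apply: eq_bigr => B _; rewrite subn0.
rewrite big_mkpart // big_map -e (E (fun i => F i.-1)) //.
by apply: eq_bigr => B _; rewrite subn1.
Qed.

(** The cycles with cycle-product 1; these are the ones that lose 1 in the
    modified type. *)
Definition trivial_cycles x := [set B in cycles x | cycle_class x B == c0].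

Lemma trivIset_cycles x : trivIset (cycles x).
Proof.
apply/trivIsetP => B B' Bx B'x ne; apply/pred0Pn => -[i /andP[iB iB']].
by case/eqP: ne; apply: (cycle_inj Bx B'x iB iB').
Qed.

Lemma sum_cycles_cover x (S : {set {set 'I_n}}) : S \subset cycles x ->
  \sum_(B in S) #|B| = #|cover S|.
Proof. by move/trivIsetS/(_ (trivIset_cycles x))/eqP. Qed.

Lemma sum_cycles x : \sum_(B in cycles x) #|B| = n.
Proof.
rewrite (@sum_cycles_cover x) // -[RHS]card_ord -cardsT; apply: eq_card => i.
rewrite inE; apply/bigcupP.
by exists (porbit (wperm x) i); rewrite ?mem_cycles ?porbit_id.
Qed.

(** The norm of the modified type is the number of points minus the number of
    trivial cycles. *)
Lemma norm_mtype x : norm (mtype x) + #|trivial_cycles x| = n.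
Proof.
rewrite /norm; under eq_bigr => c _ do rewrite /psize sumnE (@sum_mtype id) //.
rewrite -[RHS](sum_cycles x).
have -> : #|trivial_cycles x| = \sum_(B in cycles x) (cycle_class x B == c0).
  by rewrite -sum1_card big_mkcond [RHS]big_mkcond; apply: eq_bigr => B _;
     rewrite inE; case: (B \in _) => //=; case: (_ == _).
rewrite [X in X + _](_ : _ = \sum_(B in cycles x) (#|B| - (cycle_class x B ==
  c0))).
  rewrite -big_split /=; apply: eq_bigr => B Bx; rewrite subnK //.
  by case: (_ == _) => //; apply: cycle_gt0 Bx.
rewrite [RHS](partition_big (cycle_class x) predT) //=.
by apply: eq_bigr => c _; apply: eq_bigr => B /andP[_ /eqP->].
Qed.

(** Off [D], the elements [x] and [z] act in the same way; in the action on
    pairs of a point and an element of the group, the base component that is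
    met on leaving [i] is the one at the image of [i]. *)
Definition agree D x z := forall i, i \notin D ->
  wperm z i = wperm x i /\ wbase z (wperm x i) = wbase x (wperm x i).

Lemma agree_sym D x z : agree D x z -> agree D z x.
Proof. by move=> h i /h [e1 e2]; rewrite e1 e2. Qed.

(** The cycles that do not meet [D] are not changed. *)
Lemma agree_cycle D x z B : agree D x z -> B \in cycles x -> [disjoint B & D] ->
  B \in cycles z /\ cycle_class z B = cycle_class x B.
Proof.
move=> xz Bx BD; have [i defB] := cyclesP _ _ Bx.
have nD j : j \in B -> j \notin D by move=> jB; rewrite (disjointFr BD jB).
have itE k : iter k (wperm z) i = iter k (wperm x) i /\ iter k (wperm x) i \in
  B.
  elim: k => [|k [ih iB]]; first by rewrite defB porbit_id.
  by rewrite !iterS ih cycle_step //; have [-> _] := xz _ (nD _ iB).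
have eB : porbit (wperm z) i = B.
  rewrite defB; apply/setP => j; apply/porbitP/porbitP => -[k ->]; exists k;
  by rewrite !permX; have [-> _] := itE k.
split; first by rewrite -eB mem_cycles.
rewrite -{1}eB {1}defB !cycle_classE /cycle_product eB -defB; congr cclass.
have -> : traject (wperm z) i #|B| = traject (wperm x) i #|B|.
  apply: (@eq_from_nth _ i); rewrite ?size_traject // => k kB.
  by rewrite !nth_traject //; have [-> _] := itE k.
rewrite !big_seq; apply: eq_bigr => j; rewrite mem_rev {1}defB.
rewrite mem_traject_porbit -defB => jB.
have pB : (wperm x)^-1%g j \in B by rewrite -(cycle_step _ Bx) permKV.
by have [_] := xz _ (nD _ pB); rewrite permKV.
Qed.

(** The sets of points that do not meet [D]. *)
Definition off D : pred {set 'I_n} := fun B => [disjoint B & D].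

(** The number of cycles of [x] with class [c] and length [k] whose support
    satisfies [P]. *)
Definition ncycles (P : pred {set 'I_n}) x c k :=
  #|[set B in cycles x | [&& P B, cycle_class x B == c & #|B| == k]]|.

Lemma ncycles_split D x c k : 
  #|[set B in cycles x | (cycle_class x B == c) && (#|B| == k)]| =
  ncycles (off D) x c k +
  ncycles (predC (off D)) x c k.
Proof.
rewrite -(cardsID [set B | off D B]); congr (_ + _); apply: eq_card => B.
  by rewrite !inE -andbA; congr (_ && _); rewrite andbC.
by rewrite !inE andbCA.
Qed.

Lemma mem_cycles_agree D x z B : agree D x z -> off D B ->
  (B \in cycles x) = (B \in cycles z).
Proof.
move=> xz BD; apply/idP/idP => BC; first by have [] := agree_cycle xz BC BD.
by have [] := agree_cycle (agree_sym xz) BC BD.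
Qed.

Lemma ncycles_agree D x z c k : agree D x z ->
  ncycles (off D) x c k = ncycles (off D) z c k.
Proof.
move=> xz; apply: eq_card => B; rewrite !inE.
have [BD|] := boolP (off D B); last by rewrite !andbF.
rewrite -(mem_cycles_agree xz BD); case Bx: (B \in cycles x) => //=.
by have [_ ->] := agree_cycle xz Bx BD.
Qed.

End Cycles.

(** * Products by a single cycle *)

Section Products.
Variables (gT : finGroupType) (n : nat).
Implicit Types (x y z : wreath gT n) (D B : {set 'I_n}) (c : conjClass gT).
Notation c0 := (c0 gT).

Lemma wperm_mul x y i : wperm (x * y)%g i = wperm x (wperm y i).
Proof. by rewrite /= permM. Qed.

Lemma wbase_mul x y i :
  wbase (x * y)%g i = (wbase x i * wbase y ((wperm x)^-1%g i))%g.
Proof. by rewrite ffunE. Qed.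

(** The element [x] has a trivial 1-cycle at every point of [S]. *)
Definition trivial_on (S : {set 'I_n}) x :=
  forall i, i \in S -> wperm x i = i /\ wbase x i = 1%g.

Lemma trivial_on1 S : trivial_on S 1%g.
Proof. by move=> i _; rewrite /= perm1 ffunE. Qed.

Lemma trivial_onT x : trivial_on setT x -> x = 1%g.
Proof.
case: x => g s h; congr Wreath.
  by apply/ffunP => i; rewrite ffunE; have [_] := h i (in_setT i).
by apply/permP => i; rewrite perm1; have [] := h i (in_setT i).
Qed.

Lemma agree_mul D x y : trivial_on (~: D) y -> agree D x (x * y)%g.
Proof.
move=> yD i; rewrite -in_setC => /yD[yi gi].
by rewrite wperm_mul wbase_mul permK yi gi mulg1.
Qed.

Lemma agree_mull D x y : trivial_on D x -> D \in cycles y ->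
  agree (~: D) y (x * y)%g.
Proof.
move=> xD Dy i; rewrite inE negbK -(cycle_step _ Dy) => iD.
have [xi gi] := xD _ iD; have xV : (wperm x)^-1%g (wperm y i) = wperm y i by
  rewrite -{1}xi permK.
by rewrite wperm_mul wbase_mul xi gi mul1g xV.
Qed.

Lemma cycle_product1 x B i : B \in cycles x -> #|B| = 1 -> i \in B ->
  wperm x i = i /\ cycle_product x i = wbase x i.
Proof.
move=> Bx B1 iB; have defB := cycle_eq Bx iB; split.
  have /cards1P[j Bj] : #|B| == 1 by apply/eqP.
  have : wperm x i \in B by rewrite cycle_step.
  by move: iB; rewrite Bj !inE => /eqP-> /eqP->.
by rewrite /cycle_product -defB B1 /= big_seq1.
Qed.

Lemma cclass_eq_c0 (g : gT) : cclass g = c0 -> g = 1%g.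
Proof.
by move/(congr1 val) => /= e; apply/set1gP;
  rewrite -(class1G [set: gT]) -e class_refl.
Qed.

Lemma trivial_cycle_fix x B i : B \in cycles x -> cycle_class x B = c0 ->
  #|B| = 1 -> i \in B -> wperm x i = i /\ wbase x i = 1%g.
Proof.
move=> Bx cB B1 iB; have [xi <-] := cycle_product1 Bx B1 iB; split=> //.
by apply: cclass_eq_c0; rewrite -cycle_classE -(cycle_eq Bx iB).
Qed.

Lemma trivial_on_cycle S x B : trivial_on S x -> B \in cycles x ->
  ~~ off S B -> cycle_class x B = c0 /\ #|B| = 1.
Proof.
move=> xS Bx /pred0Pn[i /andP[/= iB iS]]; have [xi gi] := xS i iS.
have B1 : #|B| = 1.
  apply/eqP/cards1P; exists i; rewrite (cycle_eq Bx iB); apply/setP => j.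
  rewrite inE; apply/porbitP/eqP => [[k ->]|->]; last first.
    by exists 0; rewrite expg0 perm1.
  by elim: k => [|k ih]; rewrite ?expg0 ?perm1 // expgSr permM ih.
split=> //; rewrite (cycle_eq Bx iB) cycle_classE.
by have [_ ->] := cycle_product1 Bx B1 iB; rewrite gi.
Qed.

(** A non-trivial cycle gives a part of the modified type. *)
Lemma nontrivial_cycle_part x B (i := #|B| - (cycle_class x B == c0)) :
  B \in cycles x -> ~~ ((cycle_class x B == c0) && (#|B| == 1)) ->
  0 < i /\ 0 < count_mem i (mtype x (cycle_class x B)).
Proof.
move=> Bx nt; have B0 := cycle_gt0 Bx.
have i0 : 0 < i.
  rewrite /i; move: nt B0; case: (_ == c0); rewrite /= ?subn0 //.
  by case: #|B| => [|[]].
split=> //; rewrite count_mtype // card_gt0; apply/set0Pn; exists B.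
by rewrite inE Bx eqxx /i subnK //=; case: (_ == _).
Qed.

Lemma mtype_eq0 x : mtype x = ptype0 gT -> x = 1%g.
Proof.
move=> x0; apply: trivial_onT => i _; have Bx := mem_cycles x i.
have [/andP[/eqP cB /eqP B1]|nt] := boolP ((cycle_class x (porbit (wperm x) i)
  == c0) && (#|porbit (wperm x) i| == 1)).
  exact: trivial_cycle_fix Bx cB B1 (porbit_id _ _).
by have [_] := nontrivial_cycle_part Bx nt; rewrite x0 ffunE.
Qed.

Lemma ncycles_trivial_on S x c i : trivial_on S x -> 0 < i ->
  ncycles (predC (off S)) x c (i + (c == c0)) = 0.
Proof.
move=> xS i0; apply/eqP; rewrite cards_eq0; apply/eqP/setP => B; rewrite !inE.
apply/and4P => -[Bx BS /eqP cB /eqP sB].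
have [c1 B1] := trivial_on_cycle xS Bx BS.
by move: sB; rewrite -cB c1 eqxx; lia.
Qed.

Lemma mtype1 : mtype (1%g : wreath gT n) = ptype0 gT.
Proof.
apply: ptype_eq => c i i0; rewrite count_mtype // (ncycles_split setT).
rewrite (ncycles_trivial_on _ (@trivial_on1 setT)) // addn0 ffunE.
rewrite (count_mkpart [::]) //=; apply/eqP; rewrite cards_eq0.
apply/eqP/setP => B; rewrite !inE; apply/and4P => -[/cycle_gt0 B0 BT _ _].
move: B0; rewrite card_gt0 => /set0Pn[j jB].
by have := disjointFr BT jB; rewrite inE.
Qed.

(** The product of an element that is trivial on [D] and of a single cycle
    with support [D] has this cycle as an additional one. *)
Lemma mtype_mul_disjoint D x y r c : 0 < r -> trivial_on D x ->
  trivial_on (~: D) y -> D \in cycles y -> cycle_class y D = c ->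
  #|D| = r + (c == c0) -> mtype (x * y)%g = add_part (mtype x) r c.
Proof.
move=> r0 xD yD Dy cD sD; apply: ptype_eq => c' i i0.
rewrite count_add_part // !count_mtype // !(ncycles_split D).
rewrite (ncycles_trivial_on _ xD) // addn0 (ncycles_agree _ _ (agree_mul x yD)).
congr (_ + _).
have [Dz cz] : D \in cycles (x * y)%g /\ cycle_class (x * y)%g D = c.
  have [] := agree_cycle (agree_mull xD Dy) Dy; last by rewrite cD.
  by rewrite -setI_eq0 setICr.
have DD : ~~ off D D.
  apply/negP; rewrite /off -setI_eq0 setIid -cards_eq0 sD; lia.
rewrite mulnb; have [/andP[/eqP-> /eqP<-]|ne] := boolP ((c' == c) && (r == i)).
  rewrite -[RHS](cards1 D); apply: eq_card => B; rewrite !inE.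
  apply/and4P/eqP => [[Bz nB _ _]|->]; last by rewrite cz sD.
  case/pred0Pn: nB => j /andP[/= jB jD]; exact: cycle_inj Bz Dz jB jD.
apply/eqP; rewrite cards_eq0; apply/eqP/setP => B; rewrite !inE.
apply/and4P => -[Bz nB /eqP cB /eqP sB].
case/pred0Pn: nB => j /andP[/= jB jD].
have eB := cycle_inj Bz Dz jB jD; case/negP: ne.
have ec : c' = c by rewrite -cB eB cz.
by rewrite ec eqxx /=; move: sB; rewrite eB sD ec => /addIn->.
Qed.

(** An element of modified type [(r)_c] is a single cycle. *)
Lemma mtype_single y r c : 0 < r -> mtype y = single r c ->
  exists D, [/\ D \in cycles y, cycle_class y D = c, #|D| = r + (c == c0) &
                trivial_on (~: D) y].
Proof.
move=> r0 ey; have cnt c' i : 0 < i ->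
    #|[set B in cycles y | (cycle_class y B == c') && (#|B| == i + (c' == c0))]|
    = (c' == c) * (r == i).
  move=> i0; rewrite -count_mtype // ey singleE count_add_part // ffunE.
  by rewrite (count_mkpart [::]).
have := cnt c r r0; rewrite !eqxx muln1 => /eqP/cards1P[D defD].
have : D \in [set D] by rewrite inE.
rewrite -[in X in _ \in X]defD inE => /and3P[Dy /eqP cD /eqP sD].
exists D; split=> // i; rewrite inE => iD.
have By := mem_cycles y i; move: (porbit_id (wperm y) i) By.
move: (porbit _ _) => B iB By.
have [/andP[/eqP cB /eqP B1]|nt] :=
  boolP ((cycle_class y B == c0) && (#|B| == 1)).
  exact: trivial_cycle_fix By cB B1 iB.
have [j0] := nontrivial_cycle_part By nt.
rewrite ey singleE count_add_part // ffunE (count_mkpart [::]) //= add0n.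
case: eqP => //= cB; case: eqP => //= sB _.
case/negP: iD; suff <- : B = D by [].
apply/set1P; rewrite -defD inE By cB eqxx sB cB subnK //=.
by have := cycle_gt0 By; case: (_ == _).
Qed.

End Products.

(** * The terms of top degree *)

Section TopDegree.
Variables (gT : finGroupType) (n : nat).
Implicit Types (x y z : wreath gT n) (D B : {set 'I_n}) (c : conjClass gT).
Notation c0 := (c0 gT).

Lemma excess_mtype t x c :
  excess t (mtype x c) =
  \sum_(B in cycles x | cycle_class x B == c) (#|B| - (c == c0) - t).
Proof. exact: (@sum_mtype _ _ (fun i => i - t)). Qed.

(** The cycles of [x] that meet [D]. *)
Definition touched D x := [set B in cycles x | ~~ off D B].

Lemma touchedE D x : touched D x = porbit (wperm x) @: D.
Proof.
apply/setP => B; rewrite inE; apply/andP/imsetP => [[Bx]|[i iD ->]].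
  by case/pred0Pn => i /andP[/= iB iD]; exists i => //; apply: cycle_eq.
rewrite mem_cycles; split=> //; apply/pred0Pn; exists i.
by rewrite /= porbit_id.
Qed.

Lemma card_touched D x : #|touched D x| <= #|D|.
Proof. by rewrite touchedE leq_imset_card. Qed.

Lemma sum_cycles_split D x (P : pred {set 'I_n}) (F : {set 'I_n} -> nat) :
  \sum_(B in cycles x | P B) F B =
  \sum_(B in cycles x | off D B && P B) F B + \sum_(B in touched D x | P B) F B.
Proof.
rewrite (bigID (off D)) /=; congr (_ + _); apply: eq_bigl => B.
  by rewrite -andbA; congr (_ && _); rewrite andbC.
by rewrite inE -!andbA; congr (_ && _); rewrite andbC.
Qed.

Lemma sum_off_agree D x z c (F : {set 'I_n} -> nat) : agree D x z ->
  \sum_(B in cycles x | off D B && (cycle_class x B == c)) F B =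
  \sum_(B in cycles z | off D B && (cycle_class z B == c)) F B.
Proof.
move=> xz; apply: eq_bigl => B.
have [BD|] := boolP (off D B); last by rewrite !andbF.
rewrite -(mem_cycles_agree xz BD); case Bx: (B \in cycles x) => //=.
by have [_ ->] := agree_cycle xz Bx BD.
Qed.

(** The trivial cycles of [x] that meet [D]. *)
Definition touched_trivial D x :=
  [set B in touched D x | cycle_class x B == c0].

Lemma touched_trivialE D x : #|touched_trivial D x| =
  \sum_(B in touched D x | cycle_class x B == c0) 1.
Proof. by rewrite -sum1_card; apply: eq_bigl => B; rewrite inE. Qed.

Lemma touched_trivial_sub D x : touched_trivial D x \subset touched D x.
Proof. by apply/subsetP => B; rewrite inE => /andP[]. Qed.

Lemma touched_all_trivial D x B :
  #|touched_trivial D x| = #|touched D x| -> B \in touched D x ->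
  cycle_class x B = c0.
Proof.
move=> e; rewrite -(subset_cardP e (touched_trivial_sub D x)) inE.
by case/andP => _ /eqP.
Qed.

(** The norm of the modified type goes up by the number of trivial cycles
    that are lost. *)
Lemma card_touched_trivial D x z r : agree D x z ->
  norm (mtype z) = norm (mtype x) + r ->
  #|touched_trivial D x| = #|touched_trivial D z| + r.
Proof.
move=> xz nrm; have E w : #|trivial_cycles w| =
    \sum_(B in cycles w | off D B && (cycle_class w B == c0)) 1 +
    #|touched_trivial D w|.
  rewrite touched_trivialE -sum1_card -(sum_cycles_split D).
  by apply: eq_bigl => B; rewrite inE.
have := norm_mtype x; have := norm_mtype z.
by rewrite nrm !E (sum_off_agree _ _ xz); lia.
Qed.

Lemma ncycles_touched0 D z k : touched_trivial D z = set0 ->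
  ncycles (predC (off D)) z c0 k = 0.
Proof.
move=> z0; apply/eqP; rewrite cards_eq0 -subset0; apply/subsetP => B.
rewrite inE => /and4P[Bz /= nB cB _].
by rewrite -z0 !inE Bz nB.
Qed.

(** If the points of [D] are in different cycles of [x], multiplying [x] by a
    cycle with support [D] merges these cycles. *)
Lemma touched_merge D x y : {in D &, injective (porbit (wperm x))} ->
  D \in cycles y -> trivial_on (~: D) y -> #|touched D (x * y)%g| <= 1.
Proof.
move=> inj Dy yD; set z := (x * y)%g.
have step d : d \in D -> wperm y d \in porbit (wperm z) d.
  move=> dD; have eD : wperm y d \in D by rewrite (cycle_step _ Dy).
  move: eD; move def_e: (wperm y d) => e eD.
  have ex : exists k, (0 < k) && (iter k (wperm x) e == e).
    exists #|porbit (wperm x) e|.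
    by rewrite lt0n card_porbit_neq0 iter_porbit eqxx.
  (* From [d], the powers of [x * y] follow the whole cycle of [x] through
     [e], since it does not meet [D] again before [e]. *)
  case: (ex_minnP ex) => k /andP[k0 /eqP itk] kmin.
  suff it j : 0 < j <= k -> iter j (wperm z) d = iter j (wperm x) e.
    by rewrite -itk -it ?k0 //= -permX mem_porbit.
  elim: j => // -[_ _|j ih /andP[_ jk]]; first by rewrite /= wperm_mul def_e.
  rewrite iterS ih ?(ltnW jk) // [in RHS]iterS wperm_mul; congr (wperm x _).
  have [] // := yD (iter j.+1 (wperm x) e).
  rewrite inE; apply: contraTN jk => itD; rewrite -ltnNge ltnS.
  apply: kmin; rewrite /= -[X in _ == X](inj _ _ itD eD) //.
  by rewrite -permX porbit_perm.
rewrite touchedE; apply/card_le1_eqP => _ _ /imsetP[d dD ->] /imsetP[e eD ->].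
have : e \in porbit (wperm y) d by rewrite -(cycle_eq Dy dD).
case/porbitP => k ->; elim: k => [|k]; first by rewrite expg0 perm1.
rewrite expgSr permM => <-; apply/eqP; rewrite eq_porbit_mem step //.
by rewrite (cycle_eq Dy dD) mem_porbit.
Qed.

(** If [z] has a single cycle [E] in place of [r + 1] trivial cycles of [x],
    then [E] gives the part obtained by adding up [r] and the parts of those
    cycles: each cycle of length [b] gave the part [b - 1]. *)
Lemma merge_dominates D x z r E : agree D x z ->
  #|touched_trivial D x| = r.+1 -> #|touched D x| = r.+1 ->
  touched D z = [set E] -> cycle_class z E = c0 ->
  forall c, psize (add_part (mtype x) r c0 c) = psize (mtype z c) /\
    dominates (mtype z c) (add_part (mtype x) r c0 c).
Proof.
move=> xz ttx tx defE cE.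
have triv B : B \in touched D x -> cycle_class x B = c0.
  by apply: touched_all_trivial; rewrite ttx tx.
have sE : #|E| = \sum_(B in touched D x) #|B|.
  have S w : \sum_(B in cycles w) #|B| = \sum_(B in cycles w | off D B) #|B| +
      \sum_(B in touched D w) #|B|.
    rewrite (bigID (off D)) /=; congr (_ + _).
    by apply: eq_bigl => B; rewrite inE.
  have := etrans (sum_cycles x) (esym (sum_cycles z)); rewrite !S.
  rewrite (eq_bigl (fun B => (B \in cycles z) && off D B)) => [|B].
    by move/addnI->; rewrite defE big_set1.
  case: (boolP (off D B)) => [BD|_]; last by rewrite !andbF.
  by rewrite (mem_cycles_agree xz BD).
have exc t c : excess t (add_part (mtype x) r c0 c) <= excess t (mtype z c) /\
    (t = 0 -> excess t (add_part (mtype x) r c0 c) == excess t (mtype z c)).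
  rewrite excess_add_part !excess_mtype (sum_cycles_split D x).
  rewrite (sum_cycles_split D z) (sum_off_agree _ _ xz) -addnA.
  rewrite leq_add2l eqn_add2l.
  have [->|ne] := eqVneq c c0; last first.
    rewrite !big1 // => B /andP[BT /eqP cB]; case/eqP: ne; rewrite -cB.
      by move: BT; rewrite defE inE => /eqP->.
    by rewrite triv.
  have -> : \sum_(B in touched D z | cycle_class z B == c0) (#|B| - true - t) =
            #|E| - true - t.
    by rewrite defE big_mkcondr big_set1 cE eqxx.
  have -> : \sum_(B in touched D x | cycle_class x B == c0) (#|B| - true - t) =
            \sum_(B in touched D x) (#|B| - true - t).
    apply: eq_bigl => B; have [BT|//] := boolP (B \in touched D x).
    by rewrite (triv _ BT) eqxx.
  have -> : #|E| - true - t = \sum_(B in touched D x) (#|B| - true) + r - t.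
    congr (_ - t).
    rewrite sE -[X in X - _](_ : \sum_(B in touched D x) (#|B| - true) +
      \sum_(B in touched D x) 1 = _).
      by rewrite sum1_card tx; lia.
    rewrite -big_split /=; apply: eq_bigr => B; rewrite inE.
    by case/andP=> /cycle_gt0 B0 _; rewrite subn1 addn1 prednK.
  rewrite mul1n; split=> [|->].
    suff : \sum_(B in touched D x) (#|B| - true - t) <=
           \sum_(B in touched D x) (#|B| - true) - t by lia.
    by elim/big_rec2: _ => // B a b _; lia.
  by rewrite !subn0; under eq_bigr => B _ do rewrite subn0.
move=> c; split; first by rewrite !psizeE; have [_ /(_ erefl)/eqP] := exc 0 c.
by apply/dominates_excess => t; have [] := exc t c.
Qed.

(** The terms of top degree in the product by [K_(r)_c]. If [D] is the support
    of the cycle of [y], at most [#|D|] cycles of [x] meet [D], and the number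
    of those that are trivial exceeds by [r] its analogue for [x * y]. As
    [#|D| = r + (c == c0)], this leaves at most one trivial cycle of [x * y]
    that meets [D], and none if [c] is not [c0]. *)
Lemma mtype_mul_single x y r c : 0 < r -> mtype y = single r c ->
  norm (mtype (x * y)%g) = norm (mtype x) + r ->
  ge_step (mtype (x * y)%g) (add_part (mtype x) r c).
Proof.
move=> r0 ey nrm; split; first by rewrite norm_add_part.
have [D [Dy cD sD yD]] := mtype_single r0 ey.
set z := (x * y)%g in nrm *.
have xz : agree D x z by exact: agree_mul.
have tt_eq := card_touched_trivial xz nrm.
have tt_le w := subset_leq_card (touched_trivial_sub D w).
have ttx_le := tt_le x; have ttz_le := tt_le z.
have Tx := card_touched D x.
have [tz0|tz0] := posnP #|touched_trivial D z|.
  (* No trivial cycle of [z] meets [D]: the trivial cycles of [z] are among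
     those of [x]. *)
  have z0 k : ncycles (predC (off D)) z c0 k = 0.
    by apply: ncycles_touched0; apply/eqP; rewrite -cards_eq0 tz0.
  have c0_le i : 0 < i -> count_mem i (mtype z c0) <= count_mem i (mtype x c0).
    move=> i0; rewrite !count_mtype // !(ncycles_split D) (ncycles_agree _ _
      xz).
    by rewrite z0 addn0 leq_addr.
  have c0_le' i :
      count_mem i (mtype z c0) <= count_mem i (add_part (mtype x) r c c0).
    case: i => [|i]; first by rewrite count_part0.
    by rewrite count_add_part // (leq_trans (c0_le _ _)) // leq_addr.
  have [e|ne] := eqVneq (mtype z c0) (add_part (mtype x) r c c0); last first.
    by left; split=> // /eqP; rewrite (negPf ne).
  (* In the case of equality, [c] is not [c0] and [x] is trivial on [D], so
     that [z] has the type of [x] with the part [r] added at [c]. *)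
  have cc : (c0 == c) = false.
    apply/negP => /eqP cc; have := c0_le r r0.
    by rewrite e count_add_part // cc !eqxx; lia.
  have ttD : #|touched_trivial D x| = #|touched D x|.
    by move: sD; rewrite eq_sym cc; lia.
  suff xD : trivial_on D x.
    rewrite (mtype_mul_disjoint r0 xD yD Dy cD sD).
    by right=> c'; split=> // k.
  move=> i iD; pose B := porbit (wperm x) i.
  have BT : B \in touched D x by rewrite touchedE imset_f.
  have cB := touched_all_trivial ttD BT.
  have [Bx nB] : B \in cycles x /\ ~~ off D B by move: BT;
    rewrite inE => /andP[].
  apply: (trivial_cycle_fix Bx cB); last exact: porbit_id.
  apply/eqP/negPn/negP => B1.
  pose j := #|B|.-1; have j0 : 0 < j by have := cycle_gt0 Bx; rewrite /j; lia.
  have : count_mem j (mtype z c0) = count_mem j (mtype x c0).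
    by rewrite e count_add_part // cc addn0.
  rewrite !count_mtype // !(ncycles_split D) (ncycles_agree _ _ xz) => /addnI.
  rewrite z0 => /esym/eqP; rewrite cards_eq0 => /eqP/setP/(_ B).
  by rewrite !inE Bx /= nB cB eqxx /j addn1 prednK ?eqxx // (cycle_gt0 Bx).
(* Otherwise [c = c0] and the [r + 1] points of [D] are in as many cycles of
   [x], which are trivial and are merged into one trivial cycle of [z]. *)
have cc : c = c0.
  by apply/eqP; move: sD; case: (c == c0) => // sD; lia.
rewrite {}cc {c} eqxx addn1 in ey cD sD *.
have [ttx tx ttz] : [/\ #|touched_trivial D x| = r.+1, #|touched D x| = r.+1
    & #|touched_trivial D z| = 1] by split; lia.
have merge : #|touched D z| <= 1.
  by apply: touched_merge => //; apply/imset_injP; rewrite -touchedE tx sD.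
have /cards1P[E defE] : #|touched D z| == 1 by rewrite eqn_leq merge; lia.
right; apply: (merge_dominates xz ttx tx defE); apply: (@touched_all_trivial D).
  by rewrite ttz defE cards1.
by rewrite defE inE.
Qed.

End TopDegree.

(** * Factorizations, and elements of a given type *)

Section Existence.
Variables (gT : finGroupType).
Implicit Types (c : conjClass gT) (la mu nu : ptype gT).
Notation c0 := (c0 gT).

(** A cycle of [z] can be split off as a factor. *)
Lemma split_cycle n (z : wreath gT n) D : D \in cycles z ->
  exists x y : wreath gT n, [/\ z = (x * y)%g, trivial_on D x,
    trivial_on (~: D) y, D \in cycles y & cycle_class y D = cycle_class z D].
Proof.
move=> Dz; pose y : wreath gT n := Wreath
  [ffun i => if i \in D then wbase z i else 1%g] (restr_perm D (wperm z)).
have zD : wperm z \in 'N(D | 'P)%g.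
  by apply/astabsP => i; rewrite /= apermE cycle_step.
have yE i : i \in D -> wperm y i = wperm z i by move=> iD;
  rewrite /= restr_permE.
have yD : trivial_on (~: D) y.
  move=> i; rewrite inE => iD; rewrite /= ffunE (negPf iD); split=> //.
  exact: out_perm (restr_perm_on _ _) iD.
have zy : agree (~: D) z y.
  move=> i; rewrite inE negbK => iD; split; first exact: yE.
  by rewrite ffunE cycle_step // iD.
have [Dy cy] : D \in cycles y /\ cycle_class y D = cycle_class z D.
  by apply: (agree_cycle zy Dz); rewrite -setI_eq0 setICr.
exists (z * y^-1)%g, y; split=> //; first by rewrite mulgKV.
set x := (z * y^-1)%g; have xy : (x * y)%g = z by rewrite mulgKV.
have xD i : i \in D -> wperm x i = i.
  move=> iD; have pD : (wperm y)^-1%g i \in D by rewrite -(cycle_step _ Dy)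
    permKV.
  by rewrite -{1}(permKV (wperm y) i) -wperm_mul xy -yE // permKV.
move=> i iD; split; first exact: xD.
have : wbase (x * y)%g i = wbase z i by rewrite xy.
rewrite wbase_mul.
have -> : (wperm x)^-1%g i = i by rewrite -{1}(xD _ iD) permK.
rewrite [wbase y i]ffunE iD => e; apply: (mulIg (wbase z i)).
by rewrite e mul1g.
Qed.

(** Hence the leading coefficient in the product by [K_(r)_c] is positive. *)
Lemma factor_add_part n (z : wreath gT n) la r c : 0 < r ->
  mtype z = add_part la r c ->
  exists x y : wreath gT n,
    [/\ (x * y)%g = z, mtype x = la & mtype y = single r c].
Proof.
move=> r0 ez.
have : 0 < count_mem r (mtype z c) by rewrite ez count_add_part // !eqxx; lia.
rewrite count_mtype // card_gt0 => /set0Pn[D]; rewrite inE.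
case/and3P=> Dz /eqP cD /eqP sD.
have [x [y [def_z xD yD Dy cy]]] := split_cycle Dz.
rewrite cD in cy; exists x, y; split=> //.
  apply: (@add_part_inj _ r c).
  by rewrite -ez def_z (mtype_mul_disjoint r0 xD yD Dy cy sD).
rewrite -[y]mul1g singleE -(mtype1 gT n).
exact: mtype_mul_disjoint r0 (@trivial_on1 _ _ D) yD Dy cy sD.
Qed.

(** The union of the one-part types [(r)_c] for [(r, c)] in [L]. *)
Definition ptype_of (L : seq (nat * conjClass gT)) : ptype gT :=
  foldr (fun rc la => add_part la rc.1 rc.2) (ptype0 gT) L.

Lemma count_ptype_of L c i : 0 < i ->
  count_mem i (ptype_of L c) = count_mem (i, c) L.
Proof.
move=> i0; elim: L => [|[r c'] L ih] /=.
  by rewrite ffunE (count_mkpart [::]).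
rewrite count_add_part // ih addnC mulnb; congr (nat_of_bool _ + _).
by rewrite [c == _]eq_sym andbC.
Qed.

(** The list of the pairs [(r, c)] with [r] a part of [la c]. *)
Definition part_list la := 
  [seq (r, c) | c <- enum {: conjClass gT}, r <- parts (la c)].

Lemma part_list_pos la : all (fun rc => 0 < rc.1) (part_list la).
Proof.
apply/allP => _ /allpairsPdep[c [r [_ rc ->]]] /=.
rewrite lt0n; apply: contraTneq rc => ->.
by case: (la c) => s /= /andP[].
Qed.

Lemma part_listK la : ptype_of (part_list la) = la.
Proof.
apply: ptype_eq => c i i0; rewrite count_ptype_of // /part_list.
rewrite count_flatten -map_comp sumnE big_map big_enum /= (bigD1 c) //=.
rewrite big1 => [|c' ne]; rewrite /= count_map.
  by rewrite addn0; apply: eq_count => j /=; rewrite -pair_eqE /= eqxx andbT.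
rewrite (@eq_count _ _ pred0) ?count_pred0 // => j /=.
by rewrite -pair_eqE /= (negPf ne) andbF.
Qed.

(** The number of points of the cycles listed by [L]. *)
Definition degree (L : seq (nat * conjClass gT)) :=
  \sum_(rc <- L) (rc.1 + (rc.2 == c0)).

Lemma size_add_part la r c : 0 < r ->
  size (add_part la r c c0) = size (la c0) + (c == c0).
Proof.
move=> r0; rewrite ffunE size_sort size_filter count_cat count_nseq r0 mul1n.
rewrite [c == _]eq_sym; congr (_ + _); apply/eqP; rewrite -all_count.
apply/allP => j jl; rewrite lt0n; apply: contraTneq jl => ->.
by case: (la c0) => s /= /andP[].
Qed.

Lemma degreeE la : degree (part_list la) = norm la + size (la c0).
Proof.
rewrite -{2 3}(part_listK la); elim: (part_list la) (part_list_pos la) => /=.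
  by move=> _; rewrite /degree big_nil norm_ptype0 ffunE.
move=> [r c] L ih /= /andP[r0 /ih e].
by rewrite /degree big_cons -/(degree L) e norm_add_part size_add_part //=; lia.
Qed.

Lemma cclass_surj c : exists g, c = cclass g.
Proof.
by case: c => C CP; have /imsetP[g _ defC] := CP; exists g; apply: val_inj.
Qed.

(** A single cycle with a given support and a given cycle-product. *)
Lemma exists_cycle n (s : seq 'I_n) (g : gT) : uniq s -> s != [::] ->
  exists y : wreath gT n, [/\ [set i in s] \in cycles y,
    cycle_class y [set i in s] = cclass g & trivial_on (~: [set i in s]) y].
Proof.
case: s => // i0 q Us _; set s := i0 :: q in Us *.
pose p := perm (can_inj (prev_next Us)).
pose y : wreath gT n := Wreath [ffun i => if i == i0 then g else 1%g] p.
have [m def_q] : exists m, rcons q i0 = traject p (p i0) m.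
  apply/fpathP; have := cycle_next Us; rewrite /s /=.
  rewrite (eq_path (e' := frel (next s))) // => h.
  by rewrite (eq_path (e' := frel (next s))) // => u v; rewrite /= permE.
have def_s : s = traject p i0 (size s).
  have : rcons s i0 = traject p i0 m.+1 by rewrite /s rcons_cons def_q.
  have em : m = size s by rewrite -[m](size_traject p (p i0)) -def_q size_rcons.
  rewrite trajectSr em => /(congr1 (fun u => take (size s) u)).
  by rewrite -!cats1 !take_size_cat ?size_traject.
have eD : porbit p i0 = [set i in s].
  apply/setP => i; rewrite inE; apply/porbitP/idP => [[k ->]|].
    elim: k => [|k ih]; first by rewrite expg0 perm1 mem_head.
    by rewrite expgSr permM permE mem_next.
  by rewrite {1}def_s => /trajectP[k _ ->]; exists k; rewrite permX.
change (porbit (wperm y) i0 = [set i in s]) in eD.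
exists y; split; first by rewrite -eD mem_cycles.
  rewrite -eD cycle_classE /cycle_product eD.
  have -> : #|[set i in s]| = size s by rewrite cardsE; apply/card_uniqP.
  congr cclass; rewrite -def_s /s rev_cons -cats1 big_cat big_seq1 /=.
  rewrite ffunE eqxx big_seq big1 ?mul1g // => j; rewrite mem_rev => jq.
  rewrite ffunE; case: eqP => // ej.
  by have /andP[/negP[]] : (i0 \notin q) && uniq q by []; rewrite -ej.
move=> i; rewrite !inE => /norP[ne iq]; split; last by rewrite ffunE (negPf ne).
by rewrite /= permE next_nth inE (negPf ne) (negPf iq).
Qed.

(** The cycles are put one after the other, on the initial points. *)
Lemma exists_ptype_of n L : all (fun rc => 0 < rc.1) L -> degree L <= n ->
  exists z : wreath gT n, mtype z = ptype_of L /\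
    trivial_on [set i : 'I_n | degree L <= i] z.
Proof.
elim: L => [|[r c] L ih] /=.
  by exists 1%g; split; [exact: mtype1 | exact: trivial_on1].
rewrite {1 2}/degree big_cons -/(degree L) /=.
set k := r + _; set m := degree L => /andP[r0 /ih{}ih] kn.
have [|x [ex xD]] := ih; first by apply: leq_trans kn; apply: leq_addl.
pose s := [seq i : 'I_n <- enum 'I_n | m <= i < k + m].
have sE : size s = k.
  rewrite size_filter -(count_map _ (fun i => m <= i < k + m)) val_enum_ord.
  rewrite -size_filter (_ : [seq i <- iota 0 n | m <= i < k + m] = iota m k).
    by rewrite size_iota.
  apply: (@sorted_eq _ leq leq_trans anti_leq).
  - by apply: sorted_filter (iota_sorted _ _); apply: leq_trans.
  - exact: iota_sorted.
  apply: uniq_perm; rewrite ?filter_uniq ?iota_uniq // => i.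
  by rewrite mem_filter !mem_iota; lia.
have Us : uniq s by rewrite filter_uniq ?enum_uniq.
have [g defg] := cclass_surj c.
have [|y [Dy cy yD]] := @exists_cycle n s g Us.
  by rewrite -size_eq0 sE /k; lia.
exists (x * y)%g; split.
  rewrite -ex; apply: (mtype_mul_disjoint r0 _ yD Dy); rewrite ?cy //.
    by move=> i; rewrite inE mem_filter => /andP[/andP[mi _] _]; apply: xD;
      rewrite inE.
  by rewrite cardsE -[RHS]/k -sE; apply/card_uniqP.
move=> i; rewrite inE => ki.
have iD : i \in ~: [set i in s] by rewrite !inE mem_filter; lia.
have [xi gi] : wperm x i = i /\ wbase x i = 1%g by apply: xD; rewrite inE; lia.
have [yi hi] := yD i iD.
have xV : (wperm x)^-1%g i = i by rewrite -{1}xi permK.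
by rewrite wperm_mul wbase_mul xV yi xi gi hi mulg1.
Qed.

Lemma exists_mtype n la : norm la + size (la c0) <= n ->
  exists z : wreath gT n, mtype z = la.
Proof.
rewrite -degreeE => /(exists_ptype_of (part_list_pos la))[z [ez _]].
by exists z; rewrite ez part_listK.
Qed.

End Existence.

(** * Structure constants *)

Section StructureConstants.
Variable gT : finGroupType.
Implicit Types (c : conjClass gT) (la mu nu : ptype gT).
Notation c0 := (c0 gT).

Lemma conv_class_sum n la mu (z : wreath gT n) :
  conv (class_sum n la) (class_sum n mu) z =
  (#|[set p : wreath gT n * wreath gT n |
      [&& (p.1 * p.2)%g == z, mtype p.1 == la & mtype p.2 == mu]]|)%:R%R.
Proof.
rewrite ffunE -sum1_card natr_sum big_mkcond [RHS]big_mkcond /=.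
apply: eq_bigr => p _; rewrite inE !ffunE.
by case: (_ == z) => //=; case: (_ == la); case: (_ == mu);
  rewrite ?mulr1 ?mulr0.
Qed.

Lemma stable_constP la mu nu : exists2 z : wreath gT (norm nu + size (nu c0)),
  mtype z = nu & stable_const la mu nu =
  (#|[set p : wreath gT (norm nu + size (nu c0)) * wreath gT _ |
      [&& (p.1 * p.2)%g == z, mtype p.1 == la & mtype p.2 == mu]]|)%:R%R.
Proof.
rewrite /stable_const /str_const; case: pickP => [z /eqP ez|no].
  by exists z; rewrite ?conv_class_sum.
have [z ez] := exists_mtype (leqnn (norm nu + size (nu c0))).
by have := no z; rewrite ez eqxx.
Qed.

(** The structure constants as natural numbers. *)
Definition nat_const la mu nu : nat := `|stable_const la mu nu|%N.

Lemma stable_constE la mu nu : stable_const la mu nu = Posz (nat_const la mu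
  nu).
Proof.
by rewrite /nat_const; have [z _ ->] := stable_constP la mu nu;
  rewrite natz absz_nat.
Qed.

Lemma nat_const_gt0 la mu nu : 0 < nat_const la mu nu ->
  exists n (x y : wreath gT n),
    [/\ mtype x = la, mtype y = mu & mtype (x * y)%g = nu].
Proof.
rewrite /nat_const; have [z ez ->] := stable_constP la mu nu.
rewrite natz absz_nat card_gt0 => /set0Pn[[x y]]; rewrite inE /=.
case/and3P=> /eqP xy /eqP ex /eqP ey.
by exists (norm nu + size (nu c0)), x, y; rewrite xy.
Qed.

Lemma nat_const_single_ge la r c nu : 0 < r ->
  norm nu = norm la + r -> 0 < nat_const la (single r c) nu ->
  ptype_ge nu (add_part la r c).
Proof.
move=> r0 nrm /nat_const_gt0[n [x [y [ex ey exy]]]]; apply: t_step.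
by rewrite -exy -ex; apply: mtype_mul_single; rewrite ?exy ?ex.
Qed.

Lemma nat_const_add_part la r c : 0 < r ->
  0 < nat_const la (single r c) (add_part la r c).
Proof.
move=> r0; rewrite /nat_const.
have [z ez ->] := stable_constP la (single r c) (add_part la r c).
rewrite natz absz_nat card_gt0; have [x [y [xy ex ey]]] :=
  factor_add_part r0 ez.
by apply/set0Pn; exists (x, y); rewrite inE /= xy ex ey !eqxx.
Qed.

Lemma nat_const_ptype0 la nu : nat_const (ptype0 gT) la nu = (nu == la).
Proof.
rewrite /nat_const; have [z ez ->] := stable_constP (ptype0 gT) la nu.
rewrite natz absz_nat; case: (eqVneq nu la) => [e|ne].
  transitivity #|[set (1%g : wreath gT (norm nu + size (nu c0)), z)]|;
    last by rewrite cards1.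
  apply: eq_card => -[x y].
  rewrite !inE /= xpair_eqE; apply/and3P/andP => [[/eqP <- /eqP/mtype_eq0->
    _]|].
    by rewrite mul1g !eqxx.
  by case=> /eqP-> /eqP->; rewrite mul1g mtype1 !eqxx; split=> //; apply/eqP;
    rewrite ez.
apply/eqP; rewrite cards_eq0; apply/eqP/setP => -[x y]; rewrite !inE /=.
apply/and3P => -[/eqP exy /eqP/mtype_eq0 ex /eqP ey]; case/eqP: ne.
by rewrite -ez -exy ex mul1g.
Qed.

End StructureConstants.

Local Open Scope ring_scope.

(** * Products of generators in the Farahat-Higman ring *)

Section Ring.
Variables (gT : finGroupType) (G : comNzRingType) (K : ptype gT -> G).
Hypothesis hG : is_Farahat_Higman K.
Implicit Types (c : conjClass gT) (la mu nu : ptype gT).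

Lemma K_mul la mu : K la * K mu =
  \sum_(nu <- ptypes gT (norm la + norm mu)) K nu *+ nat_const la mu nu.
Proof.
have [_ ->] := hG; apply: eq_bigr => nu _.
by rewrite stable_constE pmulrn.
Qed.

Lemma sum_ptypes_delta la :
  \sum_(mu <- ptypes gT (norm la)) K mu *+ (mu == la) = K la.
Proof.
rewrite (bigD1_seq la) ?ptypes_uniq ?mem_ptypes //= eqxx mulr1n.
by rewrite big1 ?addr0 // => mu /negPf->.
Qed.

(** [K] at the empty type is neutral for all the elements of the basis, which
    span the ring. *)
Lemma K_ptype0 : K (ptype0 gT) = 1.
Proof.
have [[span _] _] := hG; have [s [d e]] := span 1.
rewrite -[LHS]mulr1 e mulr_sumr; apply: eq_bigr => mu _.
rewrite mulrzAr K_mul norm_ptype0 add0n; congr (_ *~ _).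
by rewrite -[RHS]sum_ptypes_delta; apply: eq_bigr => nu _;
  rewrite nat_const_ptype0.
Qed.

(** The first assertion of the theorem, for a product over any list of pairs
    [(r, c)]. *)
Lemma prod_expansion (L : seq (nat * conjClass gT)) :
  all (fun rc => 0 < rc.1)%N L ->
  exists d : ptype gT -> nat,
  [/\ \prod_(rc <- L) K (single rc.1 rc.2) =
        \sum_(mu <- ptypes gT (norm (ptype_of L))) K mu *+ d mu,
      forall mu, d mu <> 0%N -> ptype_ge mu (ptype_of L)
    & (0 < d (ptype_of L))%N].
Proof.
elim: L => [_|[r c] L ih /= /andP[r0 /ih[d [ed d_ge d_pos]]]].
  exists (fun mu => mu == ptype0 gT); split=> [|mu|]; last by rewrite /= eqxx.
    by rewrite big_nil -K_ptype0 -[LHS]sum_ptypes_delta.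
  by case: eqP => // -> _; apply: ptype_ge_refl.
set la := ptype_of L in ed d_ge d_pos *; set N := norm la.
pose e nu := (\sum_(mu <- ptypes gT N) nat_const mu (single r c) nu * d mu)%N.
exists (fun nu => if norm nu == (N + r)%N then e nu else 0%N).
rewrite norm_add_part; split=> [|nu|]; last first.
- rewrite eqxx /e (bigD1_seq la) ?ptypes_uniq ?mem_ptypes //=.
  by rewrite ltn_addr // muln_gt0 d_pos nat_const_add_part.
- case: eqP => // nrm /eqP; rewrite /e sum_nat_seq_neq0 => /hasP[mu].
  rewrite mem_ptypes /= => /eqP mN; rewrite muln_eq0 negb_or -!lt0n => /andP[a0
    d0].
  apply: (@ptype_ge_trans _ _ (add_part mu r c)).
    by apply: nat_const_single_ge => //; rewrite mN.
  by apply/ptype_ge_add/d_ge/eqP; rewrite -lt0n.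
rewrite big_cons /= ed mulr_sumr.
transitivity (\sum_(mu <- ptypes gT N) \sum_(nu <- ptypes gT (N + r)%N)
   K nu *+ (nat_const mu (single r c) nu * d mu)).
  rewrite !big_seq; apply: eq_bigr => mu; rewrite mem_ptypes => /eqP mN.
  rewrite mulrC mulrnAl K_mul mN norm_single -sumrMnl.
  by apply: eq_bigr => nu _; rewrite mulrnA.
rewrite exchange_big /= !big_seq; apply: eq_bigr => nu;
  rewrite mem_ptypes => ->.
by rewrite /e sumrMnr.
Qed.

End Ring.

(** * Algebraic independence *)

Section Independence.
Variables (gT : finGroupType) (G : comNzRingType) (K : ptype gT -> G).
Hypothesis hG : is_Farahat_Higman K.
Implicit Types (la mu nu : ptype gT).

Local Notation gen rc := (K (single rc.1.+1 rc.2)).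

Lemma sum_ptypes_extend N (S : seq (ptype gT)) (F : ptype gT -> G) :
  uniq S -> {subset ptypes gT N <= S} ->
  \sum_(mu <- ptypes gT N) F mu = \sum_(mu <- S) (if norm mu == N then F mu
    else 0).
Proof.
move=> US sub; rewrite -big_mkcond -big_filter; apply: perm_big.
apply: uniq_perm => [||mu]; [exact: ptypes_uniq|exact: filter_uniq|].
rewrite mem_ptypes mem_filter; case: eqP => //= e.
by apply/esym/sub; rewrite mem_ptypes e.
Qed.

(** The pairs [(r, c)] of the monomial [m] in the variables [K_(r)_c]. *)
Definition mon_list n (f : 'I_n -> nat * conjClass gT) (m : 'X_{1..n}) :=
  flatten [seq nseq (m i) ((f i).1.+1, (f i).2) | i <- enum 'I_n].

Lemma mon_list_pos n (f : 'I_n -> nat * conjClass gT) m :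
  all (fun rc => 0 < rc.1)%N (mon_list f m).
Proof.
apply/allP => rc /flatten_mapP[i _]; rewrite mem_nseq.
by case/andP=> _ /eqP->.
Qed.

Lemma prod_mon_list n (f : 'I_n -> nat * conjClass gT) m :
  \prod_(rc <- mon_list f m) K (single rc.1 rc.2) = mmap1 (fun i => gen (f i))
    m.
Proof.
rewrite big_flatten big_map big_enum /=; apply: eq_bigr => i _.
by rewrite big_nseq iter_mulr_1.
Qed.

Lemma mon_list_inj n (f : 'I_n -> nat * conjClass gT) : injective f ->
  injective (fun m => ptype_of (mon_list f m)).
Proof.
move=> inj m m' /ffunP e; apply/mnmP => i.
have cnt u : count_mem (f i).1.+1 (ptype_of (mon_list f u) (f i).2) = u i.
  rewrite count_ptype_of // count_flatten -map_comp sumnE big_map big_enum /=.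
  rewrite (bigD1 i) //= count_nseq /= eqxx mul1n big1 ?addn0 // => j ne.
  rewrite count_nseq /= -pair_eqE /= eqSS; case: eqP => //= e1;
    case: eqP => //= e2.
  by case/eqP: ne; apply: inj; rewrite [f j]surjective_pairing e1 e2
    -surjective_pairing.
by rewrite -[LHS]cnt e cnt.
Qed.

Lemma gen_algebraically_independent :
  algebraically_independent (fun rc : nat * conjClass gT => gen rc).
Proof.
move=> n f inj p p0; apply/eqP; rewrite -msupp_eq0; apply/negPn/negP => nz.
pose la m := ptype_of (mon_list f m).
have [d dP] := functional_choice _ (fun m => prod_expansion hG (mon_list_pos f
  m)).
have exw : exists w, has (fun m => weight (la m) == w) (msupp p).
  case: (msupp p) nz => // m s _; exists (weight (la m)); by rewrite /= eqxx.
(* In a relation, take a monomial [m0] with a type [la m0] of minimal weight: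
   the coefficient of [K (la m0)] comes from [m0] alone. *)
case: (ex_minnP exw) => w /hasP[m0 m0p /eqP def_w] wmin.
pose S := undup (flatten [seq ptypes gT (norm (la m)) | m <- msupp p]).
have sub m : m \in msupp p -> {subset ptypes gT (norm (la m)) <= S}.
  by move=> mp mu muN; rewrite mem_undup; apply/flatten_mapP; exists m.
pose D m mu := if norm mu == norm (la m) then d m mu else 0%N.
have := p0; rewrite /mmap.
have -> : \sum_(m <- msupp p) (p@_m)%:~R * mmap1 (fun i => gen (f i)) m =
  \sum_(mu <- S) K mu *~ \sum_(m <- msupp p) p@_m * (D m mu)%:R.
  under [RHS]eq_bigr => mu _ do rewrite mulrz_sumr.
  rewrite exchange_big /= !big_seq; apply: eq_bigr => m mp.
  rewrite -prod_mon_list; have [-> _ _] := dP m.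
  rewrite (sum_ptypes_extend _ (undup_uniq _) (sub m mp)) mulr_sumr.
  apply: eq_bigr => mu _; rewrite /D; case: eqP => _;
    last by rewrite !mulr0 mulr0z.
  by rewrite mulrzl mulrC mulrzA natz -pmulrn.
move=> e0; have [[_ free] _] := hG.
have laS : la m0 \in S by apply: (sub m0 m0p); rewrite mem_ptypes.
have /eqP := free S _ (undup_uniq _) e0 _ laS; apply/negP.
rewrite (bigD1_seq m0) ?msupp_uniq //= big1_seq ?addr0 => [|m /andP[ne mp]].
  have [_ _ pos] := dP m0; rewrite mulf_neq0 -?mcoeff_msupp //.
  by rewrite /D eqxx Num.Theory.pnatr_eq0 -lt0n.
rewrite /D; case: eqP => _; last by rewrite mulr0.
have [->|nz'] := eqVneq (d m (la m0)) 0%N; first by rewrite mulr0.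
have [_ /(_ (la m0) (elimN eqP nz'))/ptype_ge_weight[le eqw] _] := dP m.
case/eqP: ne; apply: (mon_list_inj inj); apply/eqP; rewrite -eqw eqn_leq le.
by rewrite -[weight (la m0)]/(weight _) def_w wmin //; apply/hasP; exists m.
Qed.

End Independence.

(** * Generation over the rationals *)

Section Span.
Variables (A : lmodType rat) (P : A -> Prop).
Hypotheses (P0 : P 0) (PDZ : forall a u v, P u -> P v -> P (a *: u + v)).

(** [P] as a boolean predicate, for the construction of a subtype. *)
Definition span_pred : {pred A} := fun a => excluded_middle_informative (P a).

Lemma span_predP a : reflect (P a) (a \in span_pred).
Proof. by rewrite unfold_in /span_pred; case: excluded_middle_informative => h;
  constructor. Qed.

Lemma span_submod_closed : submod_closed span_pred.
Proof.
split=> [|a u v /span_predP hu /span_predP hv]; first exact/span_predP.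
by apply/span_predP/PDZ.
Qed.

HB.instance Definition _ :=
  GRing.isSubmodClosed.Build rat A span_pred span_submod_closed.

Definition span_sub := {a : A | a \in span_pred}.
HB.instance Definition _ := SubChoice.on span_sub.
HB.instance Definition _ := [SubChoice_isSubLmodule of span_sub by <:].

(** A nonempty subset of [A] that is closed under linear combinations is the
    range of an injective linear map. *)
Lemma exists_submodule : exists (V : lmodType rat) (i : {linear V -> A}),
  [/\ injective i, forall v, P (i v) & forall a, P a -> exists v, i v = a].
Proof.
exists (span_sub : lmodType rat), (val : {linear span_sub -> A}).
split=> [|v|a /span_predP ha]; [exact: val_inj|exact/span_predP/valP|].
by exists (exist _ a ha).
Qed.

End Span.

Section Generation.
Variables (gT : finGroupType) (G : comNzRingType) (K : ptype gT -> G).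
Hypothesis hG : is_Farahat_Higman K.
Variables (A : comAlgType rat) (iota : {rmorphism G -> A}).
Implicit Types (la mu nu : ptype gT).

Local Notation igen rc := (iota (K (single rc.1.+1 rc.2))).

(** The rational linear combinations of products of generators. *)
Definition combination (a : A) :=
  exists S : seq (rat * seq (nat * conjClass gT)),
  a = \sum_(s <- S) s.1 *: \prod_(rc <- s.2) igen rc.

Lemma combination0 : combination 0.
Proof. by exists [::]; rewrite big_nil. Qed.

Lemma combinationDZ q a b :
  combination a -> combination b -> combination (q *: a + b).
Proof.
case=> S -> [T ->]; exists ([seq (q * s.1, s.2) | s <- S] ++ T).
rewrite big_cat big_map /= scaler_sumr; congr (_ + _).
by apply: eq_bigr => s _; rewrite scalerA.
Qed.

Lemma combinationZ q a : combination a -> combination (q *: a).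
Proof. by move=> ha; rewrite -[_ *: _]addr0;
  exact: combinationDZ combination0. Qed.

Lemma combination_sum (I : eqType) (s : seq I) (F : I -> A) :
  (forall i, i \in s -> combination (F i)) -> combination (\sum_(i <- s) F i).
Proof.
elim: s => [|i s ih] h; first by rewrite big_nil; apply: combination0.
rewrite big_cons -[F i]scale1r; apply: combinationDZ; first by apply: h;
  rewrite mem_head.
by apply: ih => j js; apply: h; rewrite inE js orbT.
Qed.

Lemma combinationMn a n : combination a -> combination (a *+ n).
Proof. by move=> ha; rewrite -scaler_nat; apply: combinationZ. Qed.

(** By descending induction on the type, since the product of the generators
    listed by [la] is a positive multiple of [K la] up to higher terms. *)
Lemma combination_K la : combination (iota (K la)).
Proof.
have [k] := ubnP ((norm la).+1 ^ 3 - weight la); elim: k la => // k ih la.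
rewrite ltnS => lek.
have [d [e d_ge d_pos]] := prod_expansion hG (part_list_pos la).
rewrite part_listK in e d_ge d_pos.
have d0 : (d la)%:R != 0 :> rat by rewrite Num.Theory.pnatr_eq0 -lt0n.
pose rest := \sum_(mu <- ptypes gT (norm la) | mu != la) iota (K mu) *+ d mu.
have -> : iota (K la) = (d la)%:R^-1 *:
    (iota (\prod_(rc <- part_list la) K (single rc.1 rc.2)) + (-1) *: rest).
  rewrite e raddf_sum (bigD1_seq la) ?ptypes_uniq ?mem_ptypes //= raddfMn.
  rewrite scaleN1r -/rest; under eq_bigr => mu _ do rewrite raddfMn.
  by rewrite addrK -scaler_nat scalerA mulVf // scale1r.
apply: combinationZ; rewrite addrC; apply: combinationDZ; last first.
  exists [:: (1, [seq (rc.1.-1, rc.2) | rc <- part_list la])].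
  rewrite big_seq1 scale1r rmorph_prod /= big_map !big_seq.
  apply: eq_bigr => -[r c] /(allP (part_list_pos la)) /= r0.
  by rewrite prednK.
rewrite /rest -big_filter; apply: combination_sum => mu.
rewrite mem_filter mem_ptypes => /andP[ne /eqP nrm].
have [->|dmu] := eqVneq (d mu) 0%N; first exact: combination0.
apply/combinationMn/ih; apply: leq_trans lek; rewrite nrm.
have [le eqw] := ptype_ge_weight (d_ge mu (elimN eqP dmu)).
apply: ltn_sub2l; first by rewrite -nrm;
  apply: leq_ltn_trans le (weight_bound _).
by rewrite ltn_neqAle eqw eq_sym ne.
Qed.

Lemma combination_iota g : combination (iota g).
Proof.
have [[span _] _] := hG; have [s [d ->]] := span g.
rewrite raddf_sum; apply: combination_sum => mu _.
rewrite raddfMz -scaler_int; exact/combinationZ/combination_K.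
Qed.

(** The span of the image of [iota] is all of [A]: by the universal property,
    [iota] factors through this span, and so does the identity of [A]. *)
Lemma combination_all : is_Q_tensor iota -> forall a, combination a.
Proof.
move=> tens a.
have [V [i [inj iP iS]]] := exists_submodule combination0 combinationDZ.
have [f fE] := functional_choice _ (fun g => iS _ (combination_iota g)).
have fB : {morph f : x y / x - y}.
  by move=> x y; apply: inj; rewrite linearB !fE raddfB.
pose fA : {additive G -> V} := HB.pack f (GRing.isZmodMorphism.Build G V f fB).
have [h [hE _]] := tens V fA; have [h1 [_ uniq]] := tens A iota.
have -> : a = i (h a).
  rewrite -[LHS]/((idfun : {linear A -> A}) a) uniq //.
  rewrite -[RHS]/((i \o h : {linear A -> A}) a) uniq // => x.
  by rewrite /= hE fE.
exact: iP.
Qed.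

Lemma gen_generates : is_Q_tensor iota ->
  generates (fun rc : nat * conjClass gT => igen rc).
Proof.
move=> tens a; have [S ->] := combination_all tens a.
pose x0 := (0%N, c0 gT); pose l := flatten [seq s.2 | s <- S].
pose T := x0 :: l.
exists (size l).+1, (fun j => nth x0 T j),
  (\sum_(s <- S) s.1 *: \prod_(rc <- s.2) 'X_(inord (index rc T))).
rewrite raddf_sum /= !big_seq; apply: eq_bigr => s sS.
rewrite mmapZ /= mulr_algl rmorph_prod /=; congr (_ *: _).
rewrite !big_seq; apply: eq_bigr => rc rcs.
have rcT : rc \in T by rewrite inE; apply/orP; right; apply/flatten_mapP;
  exists s.
rewrite mmapX mmap1U inordK ?nth_index //.
by have := rcT; rewrite -index_mem.
Qed.

End Generation.

Theorem theorem3p10 (gT : finGroupType) (G : comNzRingType)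
    (K : ptype gT -> G) (hG : is_Farahat_Higman K) :
  (forall la : ptype gT,
     exists d : ptype gT -> nat,
       [/\ \prod_(c : conjClass gT) \prod_(r <- parts (la c)) K (single r c)
             = \sum_(mu <- ptypes gT (norm la)) K mu *+ d mu,
           (forall mu, d mu <> 0%N -> ptype_ge mu la)
         & (0 < d la)%N]) /\
  (* the pair (r, c) indexes the generator K_{(r+1)_c} *)
  algebraically_independent
    (fun rc : nat * conjClass gT => K (single rc.1.+1 rc.2)) /\
  (forall (A : comAlgType rat) (iota : {rmorphism G -> A}),
     is_Q_tensor iota ->
     generates (fun rc : nat * conjClass gT => iota (K (single rc.1.+1 rc.2)))).
Proof.
split=> [la|]; last first.
  by split=> [|A iota]; [exact: gen_algebraically_independent|exact:
    gen_generates].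
have [d [e d_ge d_pos]] := prod_expansion hG (part_list_pos la).
rewrite part_listK in e d_ge d_pos; exists d; split=> //.
by rewrite -e big_allpairs_dep big_enum.
Qed.
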